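(* Let $$S_2=\langle a,b,c,d\mid aba^{-1}b^{-1}=dcd^{-1}c^{-1}\rangle.$$ Let $W$ be a finite subset of the free group $F_{\{a,b\}}$ with $1\notin W$, and let $W'$ be the subset of the free group $F_{\{c,d\}}$ obtained from $W$ via the map $a\mapsto d$, $b\mapsto c$. Let $M$ be the submonoid of $S_2$ generated by $W\cup W'$. If the submonoid of $F_{\{a,b\}}$ generated by $W$ is graded, then $M$ is graded with linear distortion. In particular, membership in $M\leq S_2$ is decidable.
   Context: For a monoid $M$ generated by a finite set $S$ and $m\in M$, $|m|_S$ is the least $k$ such that $m=s_1\cdots s_k$ with $s_i\in S$. A monoid $M$ is graded if it admits a finite generating set $S$ such that every element of $M$ can be expressed as a word over $S$ in only finitely many ways. If $M$ is a submonoid, generated by a finite set $S$, of a monoid $G$ generated by a finite set $X$ (for a group, a finite monoid generating set), a distortion function for $M$ in $G$ with respect to $S$ and $X$ is any non-decreasing function $\delta:\mathbb{N}\to\mathbb{N}$ such that $|g|_S\leq\delta(|g|_X)$ for all $g\in M$. The submonoid $M$ has linear distortion in $G$ if there is such a $\delta$ and constants $\alpha,\beta>0$ with $\delta(n)\leq\alpha n+\beta$ for all $n\in\mathbb{N}$; this does not depend on the choice of the finite generating sets. For a group $G$ generated by a finite set $B$ and a finitely generated submonoid $M\leq G$, membership in $M$ is decidable if there is an algorithm that takes any word over $B\cup B^{-1}$ and decides whether the element of $G$ it represents belongs to $M$. *)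

(* Defs.v *)
From HB Require Import structures.
From mathcomp Require Import all_boot generic_quotient.
From mathcomp Require Import boolp classical_sets cardinality.

Set Implicit Arguments.
Unset Strict Implicit.
Unset Printing Implicit Defensive.

Local Open Scope group_scope.
Local Open Scope classical_set_scope.
Local Open Scope quotient_scope.

(* The letter (i, false) stands for the generator x_i, (i, true) for x_i^-1. *)
Definition word (n : nat) := seq ('I_n * bool).

Section PresentedGroup.
Variables (n : nat) (R : seq (word n * word n)).

Definition flip_letter (l : 'I_n * bool) := (l.1, ~~ l.2).
Definition word_inv (u : word n) : word n := rev (map flip_letter u).

(* The congruence on words generated by free cancellation and by the
   relations r.1 = r.2, for r in R. *)
Inductive word_eq : word n -> word n -> Prop :=
| WordRefl u : word_eq u u
| WordSym u v : word_eq u v -> word_eq v u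
| WordTrans u v w : word_eq u v -> word_eq v w -> word_eq u w
| WordCat u u' v v' : word_eq u u' -> word_eq v v' -> word_eq (u ++ v) (u' ++ v')
| WordCancel l : word_eq [:: l; flip_letter l] [::]
| WordRel r : r \in R -> word_eq r.1 r.2.

Definition word_eqb : rel (word n) := fun u v => `[< word_eq u v >].

Lemma word_eqb_refl : reflexive word_eqb.
Proof. by move=> u; apply/asboolP; exact: WordRefl. Qed.

Lemma word_eqb_sym : symmetric word_eqb.
Proof. by move=> u v; apply/asboolP/asboolP; exact: WordSym. Qed.

Lemma word_eqb_trans : transitive word_eqb.
Proof.
by move=> v u w /asboolP uv /asboolP vw; apply/asboolP; exact: WordTrans uv vw.
Qed.

Canonical word_equiv :=
  EquivRel word_eqb word_eqb_refl word_eqb_sym word_eqb_trans.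

Definition presented : Type := {eq_quot word_equiv}.
HB.instance Definition _ := Choice.on presented.
HB.instance Definition _ := EqQuotient.on presented.

Lemma presented_piP u v : word_eq u v <-> \pi_presented u = \pi_presented v.
Proof.
split=> [uv|/eqmodP/asboolP//]; exact/eqmodP/asboolP.
Qed.

Lemma word_eq_repr u : word_eq (repr (\pi_presented u)) u.
Proof. by apply/presented_piP; rewrite reprK. Qed.

Definition presented_one : presented := \pi_presented [::].
Definition presented_mul (x y : presented) : presented := \pi_presented (repr x ++ repr y).
Definition presented_inv (x : presented) : presented := \pi_presented (word_inv (repr x)).

Lemma presented_mul_pi u v :
  presented_mul (\pi_presented u) (\pi_presented v) = \pi_presented (u ++ v).
Proof.
by apply/presented_piP; apply: WordCat; exact: word_eq_repr.
Qed.

Lemma flip_letterK : involutive flip_letter.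
Proof. by case=> i e; rewrite /flip_letter /= negbK. Qed.

Lemma word_invK : involutive word_inv.
Proof.
by move=> u; rewrite /word_inv map_rev revK -map_comp (eq_map flip_letterK) map_id.
Qed.

Lemma word_eq_mulV u : word_eq (u ++ word_inv u) [::].
Proof.
elim: u => [|l u IHu]; first exact: WordRefl.
have -> : (l :: u) ++ word_inv (l :: u) =
    [:: l] ++ ((u ++ word_inv u) ++ [:: flip_letter l]).
  by rewrite /word_inv map_cons rev_cons -cats1 /= !catA.
apply: WordTrans (WordCancel l).
rewrite -[X in word_eq _ X]/([:: l] ++ ([::] ++ [:: flip_letter l])).
apply: WordCat; first exact: WordRefl.
by apply: WordCat; [exact: IHu|exact: WordRefl].
Qed.

Lemma word_eq_mulN u : word_eq (word_inv u ++ u) [::].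
Proof. by have := word_eq_mulV (word_inv u); rewrite word_invK. Qed.

Lemma presented_mulA : associative presented_mul.
Proof.
elim/quotW=> u; elim/quotW=> v; elim/quotW=> w.
rewrite (presented_mul_pi v w) (presented_mul_pi u v).
by rewrite (presented_mul_pi u) (presented_mul_pi _ w) catA.
Qed.

Lemma presented_mul1g : left_id presented_one presented_mul.
Proof. by elim/quotW=> u; rewrite presented_mul_pi. Qed.

Lemma presented_mulg1 : right_id presented_one presented_mul.
Proof. by elim/quotW=> u; rewrite presented_mul_pi cats0. Qed.

Lemma presented_mulVg : left_inverse presented_one presented_inv presented_mul.
Proof.
move=> x; rewrite -[X in presented_mul _ X]reprK presented_mul_pi.
exact/presented_piP/word_eq_mulN.
Qed.

Lemma presented_mulgV : right_inverse presented_one presented_inv presented_mul.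
Proof.
move=> x; rewrite -[X in presented_mul X _]reprK presented_mul_pi.
exact/presented_piP/word_eq_mulV.
Qed.

HB.instance Definition _ := isGroup.Build presented presented_mulA
  presented_mul1g presented_mulg1 presented_mulVg presented_mulgV.

Definition pgen (i : 'I_n) : presented := \pi_presented [:: (i, false)].

End PresentedGroup.

Definition word_eval (G : groupType) (n : nat) (B : 'I_n -> G) (w : word n) : G :=
  \prod_(l <- w) (if l.2 then (B l.1)^-1 else B l.1).

Definition free_group (n : nat) := presented ([::] : seq (word n * word n)).

Definition free_gen (n : nat) (i : 'I_n) : free_group n := pgen [::] i.

(* The homomorphism from the free group that sends the i-th generator to B i;
   see [free_liftM] and [free_lift_gen]. *)
Definition free_lift (G : groupType) (n : nat) (B : 'I_n -> G)
  (x : free_group n) : G := word_eval B (repr x).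

Section FreeLift.
Variables (G : groupType) (n : nat) (B : 'I_n -> G).

Lemma word_eval_free_eq (u v : word n) :
  word_eq [::] u v -> word_eval B u = word_eval B v.
Proof.
rewrite /word_eval; elim=> //=.
- by move=> {}u {}v w _ -> _ ->.
- by move=> {}u u' {}v v' _ uu' _ vv'; rewrite !big_cat /= uu' vv'.
- case=> i []; rewrite !big_cons !big_nil /= mulg1.
  + exact: mulVg.
  + exact: mulgV.
Qed.

Lemma free_lift_pi (u : word n) : free_lift B (\pi_(free_group n) u) = word_eval B u.
Proof. exact/word_eval_free_eq/word_eq_repr. Qed.

Lemma free_liftM : {morph free_lift B : x y / x * y}.
Proof.
move=> x y; rewrite -[x]reprK -[y]reprK [X in free_lift _ X]presented_mul_pi.
by rewrite !free_lift_pi /word_eval big_cat.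
Qed.

Lemma free_lift_gen (i : 'I_n) : free_lift B (free_gen i) = B i.
Proof. by rewrite free_lift_pi /word_eval big_seq1. Qed.

End FreeLift.

(* Submonoids are handled as sets of elements of an ambient monoid G. *)
Section Submonoids.
Variable G : monoidType.
Implicit Types (S X M : set G) (u : seq G) (g : G).

Definition over S u : Prop := forall x, x \in u -> S x.

Definition submonoid_gen S : set G :=
  [set g | exists2 u, over S u & \prod_(x <- u) x = g].

Definition fin_generates S M : Prop := finite_set S /\ submonoid_gen S = M.

Definition graded M : Prop :=
  exists2 S, fin_generates S M &
    forall m, M m ->
      finite_set [set u : seq G | over S u /\ \prod_(x <- u) x = m].

Definition expressible S g (k : nat) : bool :=
  `[< exists2 u, over S u & size u = k /\ \prod_(x <- u) x = g >].

(* |g|_S, with the irrelevant value 0 if g is not in the submonoid generated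
   by S. *)
Definition word_length S g : nat :=
  if pselect (exists k, expressible S g k) is left gS then ex_minn gS else 0.

Definition distortion_function S X M (delta : nat -> nat) : Prop :=
  {homo delta : m n / m <= n} /\
  forall g, M g -> word_length S g <= delta (word_length X g).

(* As linear distortion does not depend on the finite generating sets S of M
   and X of G, it is required here for all of them.  Natural numbers alpha and
   beta are as good as real ones, as one can round up. *)
Definition linear_distortion M : Prop :=
  forall S X, fin_generates S M -> fin_generates X [set: G] ->
    exists2 delta, distortion_function S X M delta &
      exists alpha beta : nat, [/\ 0 < alpha, 0 < beta &
        forall n, delta n <= alpha * n + beta].

End Submonoids.

(* Kleene's partial recursive functions, the parameter being the arity. *)
Inductive recfun : nat -> Type :=
| RZero n : recfun n
| RSucc : recfun 1
| RProj n : 'I_n -> recfun n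
| RComp m n : recfun m -> ('I_m -> recfun n) -> recfun n
| RPrec n : recfun n -> recfun n.+2 -> recfun n.+1
| RMin n : recfun n.+1 -> recfun n.

(* [computes f v y]: the evaluation of f at v terminates with value y. *)
Fixpoint computes n (f : recfun n) : n.-tuple nat -> nat -> Prop :=
  match f with
  | RZero n => fun _ y => y = 0
  | RSucc => fun v y => y = (thead v).+1
  | RProj n i => fun v y => y = tnth v i
  | RComp m n h gs => fun v y =>
      exists2 t : m.-tuple nat,
        forall i, computes (gs i) v (tnth t i) & computes h t y
  | RPrec n base step => fun v y =>
      let params := [tuple of behead v] in
      let fix iterate k z := match k with
        | 0 => computes base params z
        | k'.+1 => exists2 z', iterate k' z' &
                     computes step [tuple of k' :: z' :: params] z
        end in
      iterate (thead v) y
  | RMin n h => fun v y =>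
      computes h [tuple of y :: v] 0 /\
      forall k, k < y -> exists z, computes h [tuple of k :: v] z.+1
  end.

(* Injective coding of words as numbers, by bijective numeration in base 2n. *)
Definition letter_code n (l : 'I_n * bool) : nat := l.1.*2 + l.2.

Definition word_code n (w : word n) : nat :=
  foldr (fun l c => c * n.*2 + (letter_code l).+1) 0 w.

Definition group_generates (G : groupType) n (B : 'I_n -> G) : Prop :=
  forall g, exists w, word_eval B w = g.

(* Decidability of membership does not depend on the finite family B of
   generators either. *)
Definition membership_decidable (G : groupType) (M : set G) : Prop :=
  forall n (B : 'I_n -> G), group_generates B ->
    exists f : recfun 1, forall w : word n,
      exists2 b : bool, computes f [tuple word_code w] b & (b <-> M (word_eval B w)).

(* The free generators 0, 1 are a, b in F_{a,b} and c, d in F_{c,d}. *)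
Definition Fab := free_group 2.
Definition Fcd := free_group 2.

Definition ord0_2 : 'I_2 := @Ordinal 2 0 isT.
Definition ord1_2 : 'I_2 := @Ordinal 2 1 isT.

Definition c_Fcd : Fcd := free_gen ord0_2.
Definition d_Fcd : Fcd := free_gen ord1_2.

Definition ab_to_dc : Fab -> Fcd :=
  free_lift (fun i : 'I_2 => if i == ord0_2 then d_Fcd else c_Fcd).

(* The letters of the presentation of S_2, where a, b, c, d are numbered
   0, 1, 2, 3. *)
Definition S2_letter (k : nat) (lt4 : k < 4) (e : bool) : 'I_4 * bool :=
  (Ordinal lt4, e).
Notation la := (@S2_letter 0 isT).
Notation lb := (@S2_letter 1 isT).
Notation lc := (@S2_letter 2 isT).
Notation ld := (@S2_letter 3 isT).

Definition S2_relation : word 4 * word 4 :=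
  ([:: la false; lb false; la true; lb true],
   [:: ld false; lc false; ld true; lc true]).

Definition S2 := presented [:: S2_relation].

Definition a_S2 : S2 := \pi_S2 [:: la false].
Definition b_S2 : S2 := \pi_S2 [:: lb false].
Definition c_S2 : S2 := \pi_S2 [:: lc false].
Definition d_S2 : S2 := \pi_S2 [:: ld false].

Definition Fab_to_S2 : Fab -> S2 :=
  free_lift (fun i : 'I_2 => if i == ord0_2 then a_S2 else b_S2).
Definition Fcd_to_S2 : Fcd -> S2 :=
  free_lift (fun i : 'I_2 => if i == ord0_2 then c_S2 else d_S2).

(* Main.v *)
Require Import Defs.
From HB Require Import structures.
From mathcomp Require Import all_boot generic_quotient.
From mathcomp Require Import ssralg ssrnum ssrint poly zify ring.
From mathcomp Require Import boolp classical_sets cardinality.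

Import GRing.Theory.

Set Implicit Arguments.
Unset Strict Implicit.
Unset Printing Implicit Defensive.

Local Open Scope group_scope.
Local Open Scope classical_set_scope.
Local Open Scope quotient_scope.

Local Notation over := Defs.over.

(** Folding [S2] onto the free group by [a, d |-> a] and [b, c |-> b] sends both
copies of an element of [W] back to that element.  A product of [k] generators
of [M] therefore folds onto a product of [k] elements of [W], and whatever
bounds the length of an expression over [W] also bounds the length of an
expression over the generators of [M].

In a graded submonoid of a free group that is generated by nontrivial elements,
the length of an expression is bounded linearly by the length of the element
([graded_free_linear]).  The expression spells a path in the Cayley tree, and
such a path passes through every vertex of the geodesic to its endpoint.
Between its visits to two successive vertices it spells an element of a fixed
ball; since each of the finitely many elements of the ball has boundedly many
factors in any expression, the number of factors spent per vertex is bounded.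
Applied after folding, this gives the grading and the linear distortion of [M].

For membership, the same bound leaves finitely many candidate expressions, whose
length is bounded by a computable function of the input, so that it suffices to
compare two words in [S2].  This is done by a faithful representation.  The
matrices with rows (2, 1), (1, 1) and (2, -1), (-1, 1) in SL_2(Z) generate the
group of a punctured torus, in which the commutator of the generators is
parabolic and fixes the line of (1, 0).  The shear (x, y) |-> (x + T y, y) commutes with this
commutator, so conjugating the second copy of the free group by it extends the
action to [S2].  By ping-pong, only the powers of the commutator fix the line of
(1, 0) ([stabilizer_comm_pow]); with a polynomial indeterminate for T, each
change of copy in a shortest alternating expression then raises the degree, so
nothing but 1 acts trivially ([act_faithful]).  A word of length n acts with
entries of degree at most 2n, hence two words are equal in [S2] as soon as they act in the
same way for sufficiently many integers T ([pi_eq_of_word_act]).  This is a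
statement about integer arithmetic, which is shown to be recursive by coding
all data in single natural numbers. *)

(** * Words and presented groups *)

Section PresentedGroups.
Variables (n : nat) (R : seq (word n * word n)).
Local Notation pi := (\pi_(presented R)).

Lemma pi_nil : pi [::] = 1. Proof. by []. Qed.

Lemma pi_cat u v : pi (u ++ v) = pi u * pi v.
Proof. by rewrite -presented_mul_pi. Qed.

Lemma pi_inv u : pi (word_inv u) = (pi u)^-1.
Proof.
apply/esym/mulg1_eq; rewrite -pi_cat -pi_nil.
exact/presented_piP/word_eq_mulV.
Qed.

Lemma pi_letter l :
  pi [:: l] = if l.2 then (pgen R l.1)^-1 else pgen R l.1.
Proof. by case: l => i [] //=; rewrite -pi_inv. Qed.

Lemma word_eval_pgen u : word_eval (pgen R) u = pi u.
Proof.
elim: u => [|l u IHu]; first by rewrite /word_eval big_nil pi_nil.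
by rewrite /word_eval big_cons -/(word_eval _ _) IHu -pi_letter -pi_cat.
Qed.

Lemma size_word_inv (u : word n) : size (word_inv u) = size u.
Proof. by rewrite size_rev size_map. Qed.

End PresentedGroups.

Section WordEval.
Variables (G H : groupType) (n : nat).

Lemma word_eval_cat (B : 'I_n -> G) u v :
  word_eval B (u ++ v) = word_eval B u * word_eval B v.
Proof. by rewrite /word_eval big_cat. Qed.

Lemma word_eval_eq (R : seq (word n * word n)) (B : 'I_n -> G) u v :
  (forall r, r \in R -> word_eval B r.1 = word_eval B r.2) ->
  word_eq R u v -> word_eval B u = word_eval B v.
Proof.
move=> BR; elim=> //=.
- by move=> {}u {}v w _ -> _ ->.
- by move=> {}u u' {}v v' _ uu' _ vv'; rewrite !word_eval_cat uu' vv'.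
- by case=> i []; rewrite /word_eval !big_cons big_nil /= mulg1 ?mulVg ?mulgV.
Qed.

Variable f : G -> H.
Hypothesis fM : {morph f : x y / x * y}.

Lemma morph_one : f 1 = 1.
Proof. by apply: (@mulgI _ (f 1)); rewrite -fM !mulg1. Qed.

Lemma morph_inv x : f x^-1 = (f x)^-1.
Proof. by apply/esym/mulg1_eq; rewrite -fM mulgV morph_one. Qed.

Lemma morph_prod (I : Type) (s : seq I) (F : I -> G) :
  f (\prod_(i <- s) F i) = \prod_(i <- s) f (F i).
Proof. exact: (big_morph f fM morph_one). Qed.

Lemma morph_word_eval (B : 'I_n -> G) u :
  f (word_eval B u) = word_eval (f \o B) u.
Proof.
rewrite /word_eval morph_prod; apply: eq_bigr => l _ /=.
by case: ifP => _; rewrite ?morph_inv.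
Qed.

End WordEval.

Lemma free_morph_eq (G : groupType) n (f g : free_group n -> G) :
    {morph f : x y / x * y} -> {morph g : x y / x * y} ->
    (forall i, f (free_gen i) = g (free_gen i)) -> f =1 g.
Proof.
move=> fM gM fg x; rewrite -[x]reprK -(word_eval_pgen [::]).
rewrite !morph_word_eval // /word_eval; apply: eq_bigr => l _ /=.
by rewrite [f _]fg.
Qed.

(** * Geodesics in the free group *)

Section FreeReduction.
Variable n : nat.
Implicit Types (l : 'I_n * bool) (u v : word n).

Definition push l u : word n :=
  if u is l' :: u' then (if l' == flip_letter l then u' else l :: u)
  else [:: l].

Definition reduce u : word n := foldr push [::] u.

Definition reduced u := sorted (fun l l' => l' != flip_letter l) u.

Lemma reduced_push l u : reduced u -> reduced (push l u).
Proof.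
case: u => //= l' u; case: eqP => [_|/eqP ne] /=; last by rewrite ne.
by case: u => //= l'' u /andP[].
Qed.

Lemma reduced_foldr_push u v : reduced v -> reduced (foldr push v u).
Proof. by move=> rv; elim: u => //= l u /(reduced_push l). Qed.

Lemma pushK l u : reduced u -> push l (push (flip_letter l) u) = u.
Proof.
case: u => [|l' u] /=; first by rewrite eqxx.
rewrite flip_letterK; case: (l' =P l) => [->|_]; last by rewrite /= eqxx.
by case: u => //= l'' u /andP[/negPf ->].
Qed.

(** Prepending letters one by one with cancellation is an action of the free
group on reduced words; applied to the empty word, it shows that equal words
have the same reduction. *)
Lemma foldr_push_eq u v :
  word_eq [::] u v -> forall x, reduced x -> foldr push x u = foldr push x v.
Proof.
elim=> // {u v}.
- by move=> u v _ IH x rx; rewrite IH.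
- by move=> u v w _ IH1 _ IH2 x rx; rewrite IH1 // IH2.
- move=> u u' v v' _ IH1 _ IH2 x rx.
  by rewrite !foldr_cat IH2 // IH1 // reduced_foldr_push.
- by move=> l x rx /=; rewrite pushK.
Qed.

Lemma reduce_eq u v : word_eq [::] u v -> reduce u = reduce v.
Proof. by move/foldr_push_eq; apply. Qed.

Lemma reduced_reduce u : reduced (reduce u).
Proof. exact: reduced_foldr_push. Qed.

Local Notation pi := (\pi_(free_group n)).

Lemma pi_flip l u : pi (l :: flip_letter l :: u) = pi u.
Proof.
rewrite -[_ :: _]/([:: l; flip_letter l] ++ u) pi_cat.
have -> : pi [:: l; flip_letter l] = 1 by apply/presented_piP/WordCancel.
by rewrite mul1g.
Qed.

Lemma pi_cons l u v : pi u = pi v -> pi (l :: u) = pi (l :: v).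
Proof. by move=> uv; rewrite -[l :: u]cat1s -[l :: v]cat1s !pi_cat uv. Qed.

Lemma pi_push l u : pi (push l u) = pi (l :: u).
Proof. by case: u => //= l' u; case: eqP => // ->; rewrite pi_flip. Qed.

Lemma pi_reduce u : pi (reduce u) = pi u.
Proof. by elim: u => //= l u IH; rewrite pi_push; apply: pi_cons. Qed.

Lemma size_reduce u : size (reduce u) <= size u.
Proof.
elim: u => //= l u; case: (reduce u) => //= l' v; case: ifP => _ //= lt.
exact: leq_trans (ltnW lt) (leqnSn _).
Qed.

(** Cancellation only removes backtracking: in a tree, a path visits every
vertex of the geodesic between its endpoints. *)
Lemma reduce_prefix u j : exists i, pi (take j (reduce u)) = pi (take i u).
Proof.
elim: u j => [|l u IH] j; first by exists 0.
have keep : exists i, pi (take j (l :: reduce u)) = pi (take i (l :: u)).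
  case: j => [|j]; first by exists 0.
  by have [i ui] := IH j; exists i.+1; apply: pi_cons.
rewrite /=; case: (reduce u) IH keep => [|l' v] IH //= keep.
case: eqP => [El'|_] //; have [i ui] := IH j.+1; exists i.+1.
by rewrite /= -(pi_cons l ui) /= El' pi_flip.
Qed.

Definition free_length (g : free_group n) := size (reduce (repr g)).

Lemma free_length_pi u : free_length (pi u) <= size u.
Proof. by rewrite /free_length (reduce_eq (word_eq_repr [::] u)) size_reduce. Qed.

Lemma free_lengthM g h : free_length (g * h) <= free_length g + free_length h.
Proof.
rewrite /free_length -size_cat.
rewrite -{1}[g]reprK -{1}[h]reprK -(pi_reduce (repr g)) -(pi_reduce (repr h)).
by rewrite -pi_cat; exact: free_length_pi.
Qed.

Lemma free_length_prod (I : eqType) (s : seq I) (F : I -> free_group n) L :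
    (forall i, i \in s -> free_length (F i) <= L) ->
  free_length (\prod_(i <- s) F i) <= L * size s.
Proof.
elim: s => [|i s IH] Fs; first by rewrite big_nil muln0; exact: (free_length_pi [::]).
rewrite big_cons mulnS; apply: leq_trans (free_lengthM _ _) _.
apply: leq_add; first by rewrite Fs ?mem_head.
by apply: IH => j js; rewrite Fs // inE js orbT.
Qed.

(** A vertex on the path spelled by a product lies inside one of the factors, so
it is at distance at most [C] from a partial product. *)
Lemma path_near_prefix C (ws : seq (free_group n)) i :
    (forall g, g \in ws -> size (repr g) <= C) ->
  exists t q, [/\ t <= size ws, size q <= C &
    pi (take i (flatten (map repr ws))) = \prod_(g <- take t ws) g * pi q].
Proof.
elim: ws i => [|g ws IH] i wsC.
  by exists 0, [::]; rewrite /= big_nil mul1g.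
rewrite /= take_cat; case: ltnP => [lt|ge].
  exists 0, (take i (repr g)); rewrite big_nil mul1g; split=> //.
  by rewrite size_take lt (leq_trans (ltnW lt)) // wsC ?mem_head.
have [|t [q [tws qC Et]]] := IH (i - size (repr g)).
  by move=> h hws; rewrite wsC // inE hws orbT.
by exists t.+1, q; rewrite /= big_cons pi_cat reprK Et mulgA.
Qed.

Lemma pi_flatten_repr (ws : seq (free_group n)) :
  pi (flatten (map repr ws)) = \prod_(g <- ws) g.
Proof.
by elim: ws => [|g ws IH] /=; rewrite ?big_nil // big_cons pi_cat reprK IH.
Qed.

Lemma prod_take_le (G : groupType) (ws : seq G) s t : s <= t ->
  (\prod_(g <- take s ws) g)^-1 * \prod_(g <- take t ws) g =
    \prod_(g <- drop s (take t ws)) g.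
Proof.
by move=> st; rewrite -{1}(cat_take_drop s (take t ws)) take_takel // big_cat mulKg.
Qed.

(** For each vertex of the geodesic to the product, choose a partial product that
is [C]-close to it.  The choices for successive vertices differ by a word of
length at most [2 C + 1], hence the index of the partial product grows by at
most [K] from one vertex to the next; it may also decrease. *)
Lemma length_le_free_length (S : set (free_group n)) C K :
    (forall g, S g -> size (repr g) <= C) ->
    (forall q ws, size q <= (C + C).+1 -> over S ws ->
       \prod_(g <- ws) g = pi q -> size ws <= K) ->
  forall ws, over S ws ->
    size ws <= K * (free_length (\prod_(g <- ws) g) + 2).
Proof.
move=> SC SK ws Sws; set g := \prod_(g <- ws) g.
have wsC h : h \in ws -> size (repr h) <= C by move/Sws/SC.
set r := reduce (repr g).
have Er : r = reduce (flatten (map repr ws)).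
  by apply: reduce_eq; apply/presented_piP; rewrite reprK pi_flatten_repr.
have near j : exists t q, [/\ t <= size ws, size q <= C &
    pi (take j r) = \prod_(g <- take t ws) g * pi q].
  rewrite Er; have [i ->] := reduce_prefix (flatten (map repr ws)) j.
  exact: path_near_prefix.
have over_sub s t : over S (drop s (take t ws)).
  by move=> h /mem_drop/mem_take; exact: Sws.
(* The factors between two close partial products spell an element of the ball. *)
have step s t q q' : s <= t -> t <= size ws -> size q + size q' <= (C + C).+1 ->
    \prod_(g <- take t ws) g = \prod_(g <- take s ws) g * pi q * pi q' ->
  t <= K + s.
  move=> st tw qq Et; rewrite addnC -leq_subLR.
  rewrite -{1}(size_takel tw) -size_drop.
  apply: (SK (q ++ q')); rewrite ?size_cat //.
  by rewrite -prod_take_le // Et pi_cat -!mulgA mulKg.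
have track j : j <= size r -> exists t q, [/\ t <= size ws, size q <= C,
    pi (take j r) = \prod_(g <- take t ws) g * pi q & t <= K * j.+1].
  elim: j => [|j IH] jr.
    have [t [q [tw qC Et]]] := near 0; exists t, q; split=> //.
    rewrite muln1 -[K]addn0; apply: (step _ _ [::] (word_inv q)) => //.
      by rewrite size_word_inv add0n (leq_trans qC) // ltnW // ltnS leq_addr.
    by rewrite take0 big_nil !mul1g pi_inv -[LHS](mulgK (pi q)) -Et take0 mul1g.
  have [s [q [sw qC Es sK]]] := IH (ltnW jr).
  have [t [q' [tw qC' Et]]] := near j.+1; exists t, q'; split=> //.
  rewrite mulnS; case: (leqP s t) => [st|/ltnW ts]; last first.
    by rewrite (leq_trans ts) // (leq_trans sK) // leq_addl.
  apply: leq_trans (_ : K + s <= _); last by rewrite leq_add2l.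
  have [l Ej] : exists l, take j.+1 r = rcons (take j r) l.
    case: r jr {IH near Er Es Et} => // l0 r' jr.
    by exists (nth l0 (l0 :: r') j); rewrite -take_nth.
  apply: (step _ _ q (l :: word_inv q')) => //.
    by rewrite /= size_word_inv addnS ltnS leq_add.
  rewrite -Es -[l :: _]cat1s pi_cat mulgA -(pi_cat _ (take j r) [:: l]) cats1 -Ej Et pi_inv.
  by rewrite mulgK.
have [t [q [tw qC Et tK]]] := track _ (leqnn _).
rewrite addn2 mulnS -/r; apply: leq_trans (_ : K + t <= _); last by rewrite leq_add2l.
apply: (step _ _ q [::]) => //.
  by rewrite addn0 (leq_trans qC) // ltnW // ltnS leq_addr.
by rewrite take_size -Et take_size pi_reduce reprK mulg1.
Qed.

End FreeReduction.

(** * Graded submonoids *)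

Lemma finite_bounded (T : choiceType) (A : set T) (f : T -> nat) :
  finite_set A -> exists K, forall x, A x -> f x <= K.
Proof.
move=> /finite_seqP[s ->]; exists (\max_(x <- s) f x) => x xs.
exact: leq_bigmax_seq.
Qed.

Lemma finite_short_seqs (T : choiceType) (A : set T) K : finite_set A ->
  finite_set [set u : seq T | (forall x, x \in u -> A x) /\ size u <= K].
Proof.
move=> finA; elim: K => [|K IH].
  apply: (@sub_finite_set _ _ [set [::]]) => [[|x u] []//|].
  exact: finite_set1.
apply: (@sub_finite_set _ _ ([set [::]] `|`
  [set x :: u | x in A & u in [set u : seq T | (forall x, x \in u -> A x) /\ size u <= K]])).
  move=> [|x u] [Au szu]; [by left|right].
  exists x; first by apply: Au; rewrite mem_head.
  by exists u => //; split=> // y yu; apply: Au; rewrite inE yu orbT.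
rewrite finite_setU; split; [exact: finite_set1|exact: finite_image2].
Qed.

Section Monoids.
Variable G : monoidType.
Implicit Types (S X M W : set G) (u : seq G).

Lemma submonoid_gen_sub S x : S x -> submonoid_gen S x.
Proof.
move=> Sx; exists [:: x]; last by rewrite big_seq1.
by move=> y; rewrite inE => /eqP->.
Qed.

Lemma word_length_le S u g : over S u -> \prod_(x <- u) x = g ->
  word_length S g <= size u.
Proof.
move=> Su ug; have Eu : expressible S g (size u) by apply/asboolP; exists u.
rewrite /word_length; case: pselect => [gS|[]]; last by exists (size u).
by case: ex_minnP => k _; apply.
Qed.

Lemma word_length_attained S g : submonoid_gen S g ->
  exists2 u, over S u & size u = word_length S g /\ \prod_(x <- u) x = g.
Proof.
move=> [u Su ug]; have Eu : expressible S g (size u) by apply/asboolP; exists u.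
rewrite /word_length; case: pselect => [gS|[]]; last by exists (size u).
by case: ex_minnP => k /asboolP.
Qed.

Lemma generators_expressed S W : W `<=` submonoid_gen S ->
  exists h : G -> seq G, forall x, W x -> over S (h x) /\ \prod_(y <- h x) y = x.
Proof.
move=> WS; suff /choice[h hP] : forall x, exists v,
    W x -> over S v /\ \prod_(y <- v) y = x by exists h.
move=> x; have [/WS[v Sv vx]|nWx] := pselect (W x); first by exists v.
by exists [::].
Qed.

Lemma substitute_generators S W (h : G -> seq G) u :
    (forall x, W x -> over S (h x) /\ \prod_(y <- h x) y = x) -> over W u ->
  over S (flatten (map h u)) /\ \prod_(x <- flatten (map h u)) x = \prod_(x <- u) x.
Proof.
move=> hP; elim: u => [|x u IH] Wu; first by split=> //; rewrite !big_nil.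
have [Sx Ex] := hP x (Wu x (mem_head _ _)).
have [|Su Eu] := IH; first by move=> y yu; apply: Wu; rewrite inE yu orbT.
split; last by rewrite /= big_cat /= big_cons Ex Eu.
by move=> y; rewrite mem_cat => /orP[/Sx|/Su].
Qed.

(** Being graded refers to some generating set [S].  An element of [W] is not 1, so
it is a nonempty product over [S], and replacing the factors of an expression
over [W] by such products does not shorten it. *)
Lemma graded_expressions_bounded W : graded (submonoid_gen W) -> ~ W 1 ->
  forall g, exists K, forall ws, over W ws -> \prod_(x <- ws) x = g -> size ws <= K.
Proof.
move=> [S [finS SW] gradS] W1 g.
have [h hP] : exists h : G -> seq G,
    forall x, W x -> over S (h x) /\ \prod_(y <- h x) y = x.
  by apply: generators_expressed; rewrite SW; exact: submonoid_gen_sub.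
have [Wg|nWg] := pselect (submonoid_gen W g); last first.
  by exists 0 => ws Wws Eg; case: nWg; exists ws.
have [K Kp] := finite_bounded size (gradS g Wg).
exists K => ws Wws Eg; have [Sws Ews] := substitute_generators hP Wws.
apply: leq_trans (Kp (flatten (map h ws)) _); last by split=> //; rewrite Ews.
rewrite size_flatten /shape -map_comp; elim: ws Wws {Eg Sws Ews} => //= x ws IH Wws.
rewrite -add1n leq_add //; last first.
  by apply: IH => y yws; apply: Wws; rewrite inE yws orbT.
have Wx : W x by apply: Wws; rewrite mem_head.
have [_] := hP x Wx; case: (h x) => //; rewrite big_nil => x1.
by case: W1; rewrite x1.
Qed.

End Monoids.

Lemma graded_free_linear n (W : set (free_group n)) :
    finite_set W -> ~ W 1 -> graded (submonoid_gen W) ->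
  exists K, forall ws, over W ws ->
    size ws <= K * (free_length (\prod_(g <- ws) g) + 2).
Proof.
move=> finW W1 gradW.
have [C CP] := finite_bounded (fun g : free_group n => size (repr g)) finW.
have /choice[k kP] := graded_expressions_bounded gradW W1.
have [K KP] : exists K, forall q : word n,
    (forall l, l \in q -> [set: 'I_n * bool] l) /\ size q <= (C + C).+1 ->
  k (\pi_(free_group n) q) <= K.
  apply: (finite_bounded (fun q => k (\pi_(free_group n) q))).
  by apply: finite_short_seqs; exact: finite_finset.
exists K; apply: (length_le_free_length CP) => q ws szq Wws Eq.
by apply: leq_trans (kP _ ws Wws Eq) _; apply: KP.
Qed.

(** * The surface group as a double of the free group *)

Lemma ord2P (i : 'I_2) : i = ord0_2 \/ i = ord1_2.
Proof. by case: i => [[|[|]]] // ?; [left|right]; apply: val_inj. Qed.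

(** The second copy sends [a] to [d] and [b] to [c], which is the pairing for which
the defining relation identifies the two copies of the commutator. *)
Definition copy_gen (second : bool) (i : 'I_2) : S2 :=
  if second then (if i == ord0_2 then d_S2 else c_S2)
  else (if i == ord0_2 then a_S2 else b_S2).

Definition copy (second : bool) : Fab -> S2 := free_lift (copy_gen second).

Lemma copyM second : {morph copy second : x y / x * y}.
Proof. exact: free_liftM. Qed.

Lemma copy_true x : copy true x = Fcd_to_S2 (ab_to_dc x).
Proof.
apply: (@free_morph_eq S2 2 (copy true) (Fcd_to_S2 \o ab_to_dc)) => [||i].
- exact: free_liftM.
- by move=> u v /=; rewrite /ab_to_dc free_liftM /Fcd_to_S2 free_liftM.
rewrite /copy /Fcd_to_S2 /ab_to_dc /= !free_lift_gen.
by case: ifP => Ei; rewrite /= Ei /d_Fcd /c_Fcd free_lift_gen.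
Qed.

Definition fold_gen (i : 'I_4) : Fab :=
  if (i == 0 :> nat) || (i == 3 :> nat) then free_gen ord0_2 else free_gen ord1_2.

Definition fold (s : S2) : Fab := word_eval fold_gen (repr s).

Lemma fold_pi u : fold (\pi_S2 u) = word_eval fold_gen u.
Proof.
apply: (word_eval_eq _ (word_eq_repr _ u)) => r; rewrite inE => /eqP->.
by rewrite /word_eval !big_cons !big_nil.
Qed.

Lemma foldM : {morph fold : x y / x * y}.
Proof.
by move=> x y; rewrite -[x]reprK -[y]reprK -pi_cat !fold_pi word_eval_cat.
Qed.

Lemma copyK second : cancel (copy second) fold.
Proof.
apply: (@free_morph_eq Fab 2 (fold \o copy second) id) => // [x y|i] /=.
  by rewrite copyM foldM.
rewrite /copy free_lift_gen /copy_gen.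
by case: (ord2P i) => ->; case: second; rewrite /= fold_pi /word_eval big_seq1.
Qed.

Section Double.
Variable W : set Fab.

Definition double_gens : set S2 := [set s | exists b, exists2 w, W w & copy b w = s].

Lemma double_gensE :
  Fab_to_S2 @` W `|` Fcd_to_S2 @` (ab_to_dc @` W) = double_gens.
Proof.
rewrite eqEsubset; split=> s.
  case=> [[w Ww <-]|[_ [w Ww <-] <-]]; first by exists false, w.
  by exists true, w => //; rewrite copy_true.
case=> -[] [w Ww <-]; last by left; exists w.
by right; rewrite copy_true; exists (ab_to_dc w) => //; exists w.
Qed.

Hypotheses (finW : finite_set W) (W1 : ~ W 1).
Hypothesis gradW : graded (submonoid_gen W).

Lemma finite_double_gens : finite_set double_gens.
Proof. by rewrite -double_gensE finite_setU; split; do ?apply: finite_image. Qed.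

Lemma over_fold us : over double_gens us -> over W (map fold us).
Proof.
by move=> Wus x /mapP[s /Wus[b [w Ww <-]] ->]; rewrite copyK.
Qed.

Lemma prod_fold us :
  \prod_(x <- map fold us) x = fold (\prod_(s <- us) s).
Proof. by rewrite big_map -(morph_prod foldM). Qed.

(** The number of factors can be read off after folding, which maps generators of
the double to elements of [W]. *)
Lemma double_gens_linear : exists K, forall us, over double_gens us ->
  size us <= K * (free_length (fold (\prod_(s <- us) s)) + 2).
Proof.
have [K KP] := graded_free_linear finW W1 gradW.
by exists K => us /over_fold/KP; rewrite prod_fold size_map.
Qed.

Lemma graded_double : graded (submonoid_gen double_gens).
Proof.
have [K KP] := double_gens_linear.
exists double_gens; first by split; [exact: finite_double_gens|].
move=> m _.
apply: sub_finite_set (finite_short_seqs (K * (free_length (fold m) + 2)) finite_double_gens).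
by move=> us [Wus Em]; split=> //; rewrite -Em; exact: KP.
Qed.

(** The constants [L] and [c] are the costs of passing from [X] to the free
generators after folding, and from the generators of the double to [S]. *)
Lemma linear_distortion_double : linear_distortion (submonoid_gen double_gens).
Proof.
move=> S X [finS SM] [finX Xgen]; have [K KP] := double_gens_linear.
have [L LP] := finite_bounded (fun s => free_length (fold s)) finX.
have [h hP] : exists h : S2 -> seq S2,
    forall x, double_gens x -> over S (h x) /\ \prod_(y <- h x) y = x.
  by apply: generators_expressed; rewrite SM; exact: submonoid_gen_sub.
have [c cP] := finite_bounded (fun s => size (h s)) finite_double_gens.
pose al := (c * K * L).+1; pose be := (c * K * 2).+1.
exists (fun n => al * n + be); last by exists al, be.
split=> [m n mn|g [us Wus Eg]]; first by rewrite leq_add2r leq_mul2l mn orbT.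
have [Sus Eus] := substitute_generators hP Wus; rewrite Eg in Eus.
apply: leq_trans (word_length_le Sus Eus) _.
have /word_length_attained[xs Xxs [<- Exs]] : submonoid_gen X g by rewrite Xgen.
have szc : size (flatten (map h us)) <= c * size us.
  rewrite size_flatten /shape -map_comp; elim: us Wus {Eg Sus Eus} => //= x us IH Wus.
  rewrite mulnS leq_add //; first by apply/cP/Wus; rewrite mem_head.
  by apply: IH => y yus; apply: Wus; rewrite inE yus orbT.
apply: leq_trans szc _; rewrite /al /be.
have szK : size us <= K * (L * size xs + 2).
  apply: leq_trans (KP us Wus) _; rewrite Eg leq_mul2l leq_add2r -Exs (morph_prod foldM).
  by rewrite free_length_prod ?orbT // => x /Xxs/LP.
apply: leq_trans (leq_mul (leqnn c) szK) _.
by rewrite mulnA mulnDr mulnA leq_add ?leqnSn // leq_mul2r leqnSn orbT.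
Qed.

End Double.

(** * The representation by shears *)

Section Representation.
Local Open Scope ring_scope.

Section Shears.
Variable R : comNzRingType.
Implicit Types (s T : R) (v : R * R).

Definition upper s v : R * R := (v.1 + s * v.2, v.2).
Definition lower s v : R * R := (v.1, v.2 + s * v.1).

(** For [s] equal to 1 and -1, these are the matrices with rows (2, 1), (1, 1) and
(2, -1), (-1, 1), and their inverses for [e] true, written as products of shears
so that only shears have to be handled later. *)
Definition hyperbolic s (e : bool) v :=
  if e then lower (- s) (upper (- s) v) else upper s (lower s v).

Definition free_sign (i : 'I_2) : R := if i == ord0_2 then 1 else -1.

Definition free_letter_act (l : 'I_2 * bool) := hyperbolic (free_sign l.1) l.2.

Definition free_act (g : Fab) v := foldr free_letter_act v (repr g).

Definition twist T (second : bool) v := if second then upper T v else v.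

(** Letters 0 and 3, that is [a] and [d], act as the first hyperbolic matrix. *)
Definition letter_sign (i : 'I_4) : R :=
  if (i == 0 :> nat) || (i == 3 :> nat) then 1 else -1.

Definition letter_act T (l : 'I_4 * bool) v :=
  twist T (2 <= l.1)%N (hyperbolic (letter_sign l.1) l.2 (twist (- T) (2 <= l.1)%N v)).

Definition word_act T (u : word 4) v := foldr (letter_act T) v u.

Definition act T (s : S2) v := word_act T (repr s) v.

Lemma upperK s : cancel (upper (- s)) (upper s).
Proof. by case=> x y; congr (_, _) => /=; ring. Qed.

Lemma upperNK s : cancel (upper s) (upper (- s)).
Proof. by move=> v; rewrite -{2}[s]opprK upperK. Qed.

Lemma twistK T b : cancel (twist T b) (twist (- T) b).
Proof. by case: b => // v; rewrite /twist upperNK. Qed.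

Lemma twistNK T b : cancel (twist (- T) b) (twist T b).
Proof. by case: b => // v; rewrite /twist upperK. Qed.

Lemma hyperbolicK s e : cancel (hyperbolic s e) (hyperbolic s (~~ e)).
Proof. by case=> x y; case: e; congr (_, _) => /=; ring. Qed.

(** The commutator is parabolic: minus the shear by 6.  Upper shears commute
with it, which is why conjugating one copy by them respects the relation of [S2]. *)
Lemma commutator_act v :
  hyperbolic 1 false (hyperbolic (-1) false (hyperbolic 1 true (hyperbolic (-1) true v))) =
  (- v.1 - 6 * v.2, - v.2).
Proof. by case: v => x y; rewrite /hyperbolic /upper /lower /=; congr (_, _); ring. Qed.

Lemma free_act_pi u v : free_act (\pi_(free_group 2) u) v = foldr free_letter_act v u.
Proof.
rewrite /free_act; move: (repr _) (word_eq_repr [::] u) v => u0; elim=> //.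
- by move=> {}u u' u'' _ IH1 _ IH2 v; rewrite IH1 IH2.
- by move=> {}u u' w w' _ IH1 _ IH2 v; rewrite !foldr_cat IH2 IH1.
- by case=> i e v; rewrite /= /free_letter_act /= -{1}[e]negbK hyperbolicK.
Qed.

Lemma free_actM g h v : free_act (g * h)%g v = free_act g (free_act h v).
Proof.
by rewrite -[g]reprK -[h]reprK -(pi_cat _ (repr g)) !free_act_pi foldr_cat.
Qed.

Lemma act_pi T u v : act T (\pi_S2 u) v = word_act T u v.
Proof.
rewrite /act /word_act; move: (repr _) (word_eq_repr [:: S2_relation] u) v => u0.
elim=> //.
- by move=> {}u u' u'' _ IH1 _ IH2 v; rewrite IH1 IH2.
- by move=> {}u u' w w' _ IH1 _ IH2 v; rewrite !foldr_cat IH2 IH1.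
- move=> l v; rewrite /= /letter_act /= twistK.
  by rewrite -{1}[l.2]negbK hyperbolicK twistNK.
- move=> r; rewrite inE => /eqP-> [x y]; rewrite /S2_relation /=.
  have /= comm := commutator_act.
  rewrite /letter_act /letter_sign /= !upperNK !comm.
  by rewrite /upper /=; congr (_, _); ring.
Qed.

Lemma actM T (s t : S2) v : act T (s * t)%g v = act T s (act T t v).
Proof.
by rewrite -[s]reprK -[t]reprK -(pi_cat _ (repr s)) !act_pi /word_act foldr_cat.
Qed.

End Shears.

Definition copy_letter (second : bool) (l : 'I_2 * bool) : 'I_4 * bool :=
  (if second then rev_ord (widen_ord (isT : 2 <= 4)%N l.1)
   else widen_ord (isT : 2 <= 4)%N l.1, l.2).

Lemma copy_pi second u :
  copy second (\pi_(free_group 2) u) = \pi_S2 (map (copy_letter second) u).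
Proof.
rewrite /copy free_lift_pi -word_eval_pgen /word_eval big_map.
apply: eq_bigr => -[i e] _ /=; rewrite -!/(pgen _ _).
suff -> : copy_gen second i = pgen [:: S2_relation] (copy_letter second (i, e)).1 by [].
by case: (ord2P i) => ->; case: second; congr (\pi_S2 [:: (_, _)]); apply: val_inj.
Qed.

Lemma act_copy (R : comNzRingType) (T : R) b g v :
  act T (copy b g) v = twist T b (free_act g (twist (- T) b v)).
Proof.
rewrite -[g]reprK copy_pi act_pi free_act_pi; elim: (repr g) => [|l u IH] /=.
  by rewrite twistNK.
rewrite IH /letter_act.
have -> : letter_sign R (copy_letter b l).1 = free_sign R l.1.
  by case: l => i e; case: (ord2P i) => ->; case: (b).
have -> : (2 <= (copy_letter b l).1)%N = b.
  by case: l => i e; case: (ord2P i) => ->; case: (b).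
by rewrite twistK.
Qed.

End Representation.

(** * Ping-pong on the punctured torus *)

Section PuncturedTorus.

Local Notation A := (free_gen ord0_2).
Local Notation B := (free_gen ord1_2).

Definition comm_ab : Fab := A * B * A^-1 * B^-1.

Definition comm_pow (k : int) : Fab :=
  match k with Posz n => comm_ab ^+ n | Negz n => comm_ab ^- n.+1 end.

Lemma comm_powS k : comm_ab * comm_pow k = comm_pow (k + 1)%R.
Proof.
case: k => [n|[|n]].
- by rewrite -PoszD addn1 /= expgS.
- by rewrite /= expg1 mulgV.
have -> : (Negz n.+1 + 1 = Negz n)%R by lia.
by rewrite /= [comm_ab ^+ n.+2]expgSr invgM mulVKg.
Qed.

Lemma comm_abE : comm_ab = \pi_(free_group 2)
  [:: (ord0_2, false); (ord1_2, false); (ord0_2, true); (ord1_2, true)].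
Proof.
by rewrite -word_eval_pgen /word_eval !big_cons big_nil /= mulg1 /comm_ab !mulgA.
Qed.

Lemma copy_comm_ab : copy false comm_ab = copy true comm_ab.
Proof.
rewrite comm_abE !copy_pi; apply/presented_piP.
have := @WordRel 4 [:: S2_relation] _ (mem_head _ _).
congr (word_eq _ _ _); rewrite /S2_relation /=;
  by congr [:: (_, _); (_, _); (_, _); (_, _)]; apply: val_inj.
Qed.

Lemma copy_comm_pow b k : copy b (comm_pow k) = copy false (comm_pow k).
Proof.
case: b => //; have cX n : copy true (comm_ab ^+ n) = copy false (comm_ab ^+ n).
  elim: n => [|n IH]; first by rewrite !(morph_one (@copyM _)).
  by rewrite expgS !(copyM _ comm_ab) IH copy_comm_ab.
by case: k => n; rewrite //= !(morph_inv (@copyM _)) cX.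
Qed.

Section PingPong.
Local Open Scope ring_scope.
Implicit Type v : int * int.

(** The lines of (1, 0), (1, 1), (0, 1) and (-1, 1) are the four cusps of the ideal
quadrilateral whose opposite sides are paired by the generators.  Following
them around the puncture, letter by letter, spells powers of the commutator;
the group element is thus known up to such a power as long as its image of
(1, 0) is a cusp. *)
Definition at_cusp (g : Fab) v : Prop := exists k : int,
  [\/ [/\ g = comm_pow k, v.2 = 0 & v.1 <> 0],
      [/\ g = (B^-1 * comm_pow k)%g, v.1 = v.2 & v.2 <> 0],
      [/\ g = (A^-1 * (B^-1 * comm_pow k))%g, v.1 = 0 & v.2 <> 0] |
      [/\ g = (B * (A^-1 * (B^-1 * comm_pow k)))%g, v.1 = - v.2 & v.2 <> 0]].

(** The open arc beyond the side of the quadrilateral that the letter [l] crosses,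
in terms of the slope v.1 / v.2: ]1, +oo[ and ]-1, 0[ for [a] and its inverse,
]-oo, -1[ and ]0, 1[ for [b] and its inverse. *)
Definition in_arc (l : 'I_2 * bool) v : Prop :=
  if l.1 == ord0_2 then
    (if l.2 then v.1 * (v.1 + v.2) < 0 else 0 < v.2 * (v.1 - v.2))
  else (if l.2 then 0 < v.1 * (v.2 - v.1) else (v.1 + v.2) * v.2 < 0).

(** At each cusp, two letters lead to a neighbouring cusp and multiply the group
element accordingly; the two others lead into their open arcs. *)
Lemma cusp_step l g v : at_cusp g v ->
  at_cusp (\pi_(free_group 2) [:: l] * g)%g (free_letter_act l v) \/
  in_arc l (free_letter_act l v).
Proof.
case: v => p r [k gk]; rewrite (pi_letter [::]).
have up : (A * (B * (A^-1 * (B^-1 * comm_pow k))))%g = comm_pow (k + 1).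
  by rewrite -comm_powS /comm_ab !mulgA.
have down : (A^-1 * comm_pow k)%g = (B * (A^-1 * (B^-1 * comm_pow (k - 1))))%g.
  by apply: (@mulgI _ A); rewrite mulVKg -{1}[k](subrK 1) -comm_powS /comm_ab !mulgA.
rewrite /free_letter_act /hyperbolic /upper /lower /in_arc /at_cusp /=.
case: l => i [] /=; case: (ord2P i) => -> /=; rewrite /free_sign /=;
  case: gk => -[-> /= E1 E2]; rewrite ?mulKg ?mulVKg ?up ?down.
(* The inverse of [a], the inverse of [b], [a] and [b], at the four cusps each. *)
- by left; exists (k - 1); apply: Or44; split=> //; lia.
- by left; exists k; apply: Or43; split=> //; lia.
- by right; nia.
- by right; nia.
- by left; exists k; apply: Or42; split=> //; lia.
- by right; nia.
- by right; nia.
- by left; exists k; apply: Or43; split=> //; lia.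
- by right; nia.
- by right; nia.
- by left; exists k; apply: Or42; split=> //; lia.
- by left; exists (k + 1); apply: Or41; split=> //; lia.
- by right; nia.
- by left; exists k; apply: Or41; split=> //; lia.
- by left; exists k; apply: Or44; split=> //; lia.
- by right; nia.
Qed.

(** The ping-pong step: a letter [l] maps the three arcs other than the one of its
inverse into its own arc. *)
Lemma arc_step l l' v : l' != flip_letter l -> in_arc l' v ->
  in_arc l (free_letter_act l v).
Proof.
case: v => p r; rewrite /free_letter_act /hyperbolic /upper /lower /in_arc /=.
case: l => i []; case: l' => j []; rewrite /flip_letter /=;
case: (ord2P i) => ->; case: (ord2P j) => -> //= _; rewrite /free_sign /=; nia.
Qed.

(** Once the image of (1, 0) leaves the cusps it stays in open arcs, where the
reducedness of the word guarantees that [arc_step] applies. *)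
Lemma ping_pong u : reduced u ->
  let v := foldr (@free_letter_act int) (1, 0) u in
  at_cusp (\pi_(free_group 2) u) v \/ (exists l u', u = l :: u' /\ in_arc l v).
Proof.
elim: u => [|l u IH] /= ru; first by left; exists 0; apply: Or41.
have [|cusp|[l' [u' [Eu arc]]]] := IH; first by case: u ru {IH} => //= ? ? /andP[].
  case: (cusp_step l cusp) => [c|a]; last by right; exists l, u.
  by left; rewrite -cat1s pi_cat.
right; exists l, u; split=> //; apply: arc_step arc.
by move: ru; rewrite Eu /= => /andP[].
Qed.

(** Neither the other three cusps nor the open arcs meet the line of (1, 0). *)
Lemma stabilizer_comm_pow (g : Fab) :
  (free_act g (1, 0) : int * int).2 = 0 -> exists k, g = comm_pow k.
Proof.
rewrite -[g]reprK -pi_reduce free_act_pi.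
case: (ping_pong (reduced_reduce (repr g))) => [[k]|[l [u' [-> ]]]].
  rewrite pi_reduce reprK; move: (foldr _ _ _) => -[p r] /=.
  by case=> -[Eg E1 E2] E3; [exists k|lia..].
move: (foldr _ _ _) => -[p r]; rewrite /in_arc /= => arc r0.
by move: arc; rewrite r0; case: ifP => _; case: ifP => _; nia.
Qed.

(** The upper entry, which determines [k], is what tells powers of the commutator
apart. *)
Lemma comm_pow_act k : exists2 y, y <> 0 &
  (free_act (comm_pow k) (0, 1) : int * int) = (6 * k * y, y).
Proof.
have actz v : free_act comm_ab v = (- v.1 - 6 * v.2, - v.2) :> (int * int)%type.
  by rewrite comm_abE free_act_pi /= -(commutator_act v).
have act1 : free_act 1%g (0, 1) = (0, 1) :> (int * int)%type.
  exact: (free_act_pi [::]).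
pose P k' := exists2 y, y <> 0 &
  (free_act (comm_pow k') (0, 1) : int * int) = (6 * k' * y, y).
have up k' : P k' -> P (k' + 1).
  case=> y y0 Ey; exists (- y); first by lia.
  by rewrite -comm_powS free_actM Ey actz /=; congr (_, _); ring.
have down k' : P k' -> P (k' - 1).
  case=> y y0 Ey; exists (- y); first by lia.
  have := actz (free_act (comm_pow (k' - 1)) (0, 1)).
  rewrite -free_actM comm_powS subrK Ey; case: (free_act _ _) => a b /= [].
  by move=> E1 E2; congr (_, _); lia.
elim/int_rect: k => [|n IH|n IH]; first by exists 1 => //=; rewrite act1.
  by rewrite -addn1 PoszD; exact: up.
by rewrite -addn1 PoszD opprD; exact: down.
Qed.
End PingPong.

End PuncturedTorus.

(** * Faithfulness *)

Section Faithfulness.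
Local Open Scope ring_scope.

(** The matrix of [g] has the same integer entries over every ring, so what
ping-pong says over the integers can be used over polynomials. *)
Lemma free_act_linear (R : comNzRingType) g (x y : R) :
  let c0 := free_act g (1, 0) : int * int in
  let c1 := free_act g (0, 1) : int * int in
  free_act g (x, y) =
    (c0.1%:~R * x + c1.1%:~R * y, c0.2%:~R * x + c1.2%:~R * y).
Proof.
rewrite -[g]reprK !free_act_pi; elim: (repr g) => [|l u /= ->] /=.
  by congr (_, _); ring.
move: (foldr _ _ _) (foldr _ _ _) => -[p r] [q s] /=.
rewrite /free_letter_act /hyperbolic /upper /lower /=.
by case: l => i []; case: (ord2P i) => ->; rewrite /free_sign /=; congr (_, _); ring.
Qed.

Definition top_heavy (v : {poly int} * {poly int}) := (size v.2 < size v.1)%N.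
Definition bottom_heavy (v : {poly int} * {poly int}) :=
  (0 < size v.2)%N && (size v.1 <= size v.2)%N.

Lemma poly_intr (a : int) : a%:~R = a%:P :> {poly int}.
Proof. by rewrite -{2}[a]intz rmorph_int. Qed.

(** The lower left entry of [g] is a nonzero constant by ping-pong, so the degree of
the upper component is passed on to the lower one. *)
Lemma bottom_heavy_free_act g v : ~ (exists k, g = comm_pow k) ->
  top_heavy v -> bottom_heavy (free_act g v).
Proof.
case: v => x y ng; rewrite /top_heavy /bottom_heavy /= => yx.
have r0 : (free_act g (1, 0) : int * int).2 != 0.
  by apply/eqP => /stabilizer_comm_pow.
have szM (a : int) (w : {poly int}) : (size (a%:~R * w)%R <= size w)%N.
  by rewrite poly_intr mul_polyC size_scale_leq.
have szx : size ((free_act g (1, 0) : int * int).2%:~R * x) = size x.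
  by rewrite poly_intr mul_polyC size_scale.
rewrite free_act_linear /= size_polyDl szx; last exact: leq_ltn_trans (szM _ _) yx.
rewrite (leq_ltn_trans _ yx) //=.
apply: leq_trans (size_polyD _ _) _; rewrite geq_max szM.
exact: leq_trans (szM _ _) (ltnW yx).
Qed.

Lemma top_heavy_upper (T : {poly int}) v :
  size T = 2 -> bottom_heavy v -> top_heavy (upper T v).
Proof.
case: v => x y szT /andP[/= y0 xy]; rewrite /top_heavy /=.
have szTy : size (T * y) = (size y).+1.
  rewrite size_mul ?szT //; first by rewrite -size_poly_gt0 szT.
  by rewrite -size_poly_gt0.
by rewrite addrC size_polyDl szTy.
Qed.

Definition alt_eval (L : seq (bool * Fab)) : S2 := (\prod_(x <- L) copy x.1 x.2)%g.

Definition shortest L :=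
  forall L', alt_eval L' = alt_eval L -> (size L <= size L')%N.

Lemma alt_eval_cons x L : alt_eval (x :: L) = (copy x.1 x.2 * alt_eval L)%g.
Proof. by rewrite /alt_eval big_cons. Qed.

Lemma shortest_tail x L : shortest (x :: L) -> shortest L.
Proof.
move=> minL L' EL'; have := minL (x :: L').
by rewrite !alt_eval_cons EL' => /(_ erefl).
Qed.

(** Two adjacent factors of the same copy could be merged, and a power of the
commutator belongs to both copies, so it could be merged with its neighbour. *)
Lemma shortest_alternates b g b' g' L : shortest ((b, g) :: (b', g') :: L) ->
  [/\ b' = ~~ b, ~ (exists k, g = comm_pow k) & ~ (exists k, g' = comm_pow k)].
Proof.
move=> minL.
have merge c h : copy c h <> (copy b g * copy b' g')%g.
  move=> Eh; have := minL ((c, h) :: L).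
  by rewrite !alt_eval_cons Eh mulgA => /(_ erefl) /=; rewrite ltnn.
split.
- case: (b =P b') => [Eb|]; last by case: b {minL merge}; case: b'.
  by case: (merge b (g * g')%g); rewrite copyM Eb.
- by case=> k Eg; case: (merge b' (g * g')%g); rewrite copyM Eg !(copy_comm_pow _ k).
- by case=> k Eg; case: (merge b (g * g')%g); rewrite copyM Eg !(copy_comm_pow _ k).
Qed.

Lemma twist_e1 T b : twist T b (1, 0) = (1, 0) :> ({poly int} * {poly int})%type.
Proof. by case: b => //=; congr (_, _); rewrite /= mulr0 addr0. Qed.

(** Between two factors from different copies stands a shear by the indeterminate,
which makes a bottom heavy vector top heavy, while a factor does the reverse;
no cancellation of leading terms can occur. *)
Lemma shortest_bottom_heavy b g L : shortest ((b, g) :: L) ->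
    ~ (exists k, g = comm_pow k) ->
  bottom_heavy (twist (- 'X) b (act 'X (alt_eval ((b, g) :: L)) (1, 0))).
Proof.
elim: L b g => [|[b' g'] L IH] b g minL ng.
  rewrite /alt_eval big_seq1 act_copy twistK twist_e1.
  by apply: bottom_heavy_free_act; rewrite // /top_heavy /= size_poly0 size_poly1.
have [Eb _ ng'] := shortest_alternates minL.
rewrite alt_eval_cons actM act_copy twistK; apply: bottom_heavy_free_act => //.
have := IH b' g' (shortest_tail minL) ng'; rewrite {}Eb.
move: (act _ _ _) => v; case: (b) => /= bh; last first.
  by rewrite -[v](upperK 'X); apply: top_heavy_upper; rewrite ?size_polyX.
by apply: top_heavy_upper; rewrite ?size_polyN ?size_polyX.
Qed.

Lemma alt_eval_surj s : exists L, alt_eval L = s.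
Proof.
rewrite -[s]reprK; elim: (repr s) => [|l u [L EL]].
  by exists [::]; rewrite /alt_eval big_nil.
have [x Ex] : exists x, copy x.1 x.2 = \pi_S2 [:: l].
  pose c := (2 <= l.1)%N.
  pose i := if (l.1 == 0 :> nat) || (l.1 == 3 :> nat) then ord0_2 else ord1_2.
  exists (c, \pi_(free_group 2) [:: (i, l.2)]); rewrite copy_pi /=.
  congr (\pi_S2 [:: _]); rewrite /c /i; case: l {c i} => -[m lt4] e /=.
  by congr (_, _); apply: val_inj; case: m lt4 => [|[|[|[|]]]].
by exists (x :: L); rewrite alt_eval_cons EL Ex -[l :: u]cat1s pi_cat.
Qed.

Lemma shortest_exists s : exists2 L, shortest L & alt_eval L = s.
Proof.
have [L0 EL0] := alt_eval_surj s.
pose P n := `[< exists2 L, size L = n & alt_eval L = s >].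
have exP : exists n, P n by exists (size L0); apply/asboolP; exists L0.
case: (ex_minnP exP) => n /asboolP[L szL EL] minn; exists L => // L' EL'.
by rewrite szL; apply: minn; apply/asboolP; exists L'; rewrite // EL'.
Qed.

(** By the growth of degrees, a shortest expression of an element that fixes (1, 0)
begins with a power of the commutator, hence has no second factor; the image of
(0, 1) then determines the exponent. *)
Lemma act_faithful s : act ('X : {poly int}) s (1, 0) = (1, 0) ->
  act ('X : {poly int}) s (0, 1) = (0, 1) -> s = 1%g.
Proof.
have [[|[b g] L] minL <-] := shortest_exists s; first by rewrite /alt_eval big_nil.
move=> e1 e2.
have [[k Eg]|ng] := pselect (exists k, g = comm_pow k); last first.
  have := shortest_bottom_heavy minL ng.
  by rewrite e1 twist_e1 /bottom_heavy /= size_poly0.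
case: L minL e1 e2 => [|[b' g'] L] minL; last first.
  by case: (shortest_alternates minL) => _ []; exists k.
rewrite /alt_eval big_seq1 /= Eg copy_comm_pow => _; rewrite act_copy /=.
rewrite free_act_linear; have [y y0 ->] /= := comm_pow_act k.
rewrite !mulr0 !add0r !mulr1 => -[/eqP].
rewrite poly_intr polyC_eq0 mulf_eq0 (negPf (introN eqP y0)) orbF mulf_eq0 /= => /eqP -> _.
exact: (morph_one (@copyM false)).
Qed.

(** * Specialisation of the parameter at integers *)

Lemma poly_eq_at_points (p q : {poly int}) D : (size p <= D)%N -> (size q <= D)%N ->
  (forall k : nat, (k < D)%N -> p.[k%:Z] = q.[k%:Z]) -> p = q.
Proof.
move=> pD qD pq; apply/eqP; rewrite -subr_eq0; apply/negP => /negP nz.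
have szpq : (size (p - q)%R <= D)%N.
  by rewrite (leq_trans (size_polyD _ _)) // geq_max pD size_polyN.
suff : (D < size (p - q)%R)%N by rewrite ltnNge szpq.
rewrite -[D](size_iota 0) -(size_map Posz); apply: max_poly_roots nz _ _.
  apply/allP => _ /mapP[k kD ->]; rewrite rootE hornerD hornerN pq ?subrr //.
  by move: kD; rewrite mem_iota.
by rewrite map_inj_uniq ?iota_uniq // => ? ? [].
Qed.

Definition eval_pair (T : int) (v : {poly int} * {poly int}) : int * int :=
  (v.1.[T], v.2.[T]).

Lemma eval_word_act (T : int) u v :
  eval_pair T (word_act 'X u v) = word_act T u (eval_pair T v).
Proof.
have upE (s : {poly int}) w : eval_pair T (upper s w) = upper s.[T] (eval_pair T w).
  by rewrite /eval_pair /upper /= hornerD hornerM.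
have loE (s : {poly int}) w : eval_pair T (lower s w) = lower s.[T] (eval_pair T w).
  by rewrite /eval_pair /lower /= hornerD hornerM.
have twE (s : {poly int}) b w : eval_pair T (twist s b w) = twist s.[T] b (eval_pair T w).
  by case: b => //; rewrite /twist upE.
elim: u => [//|l u /= <-]; rewrite /letter_act twE !hornerE; congr (twist _ _ _).
have sE : (letter_sign {poly int} l.1).[T] = letter_sign int l.1.
  by rewrite /letter_sign; case: ifP => _; rewrite ?hornerN hornerC.
by rewrite /hyperbolic; case: l.2; rewrite ?(upE, loE, twE) ?hornerN ?hornerX sE.
Qed.

Definition size_le k (v : {poly int} * {poly int}) :=
  (size v.1 <= k)%N && (size v.2 <= k)%N.

Lemma size_le_upper (s : {poly int}) d k v :
  (size s <= d.+1)%N -> size_le k v -> size_le (k + d)%N (upper s v).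
Proof.
move=> sd /andP[v1 v2]; rewrite /size_le /= (leq_trans v2) ?leq_addr // andbT.
apply: leq_trans (size_polyD _ _) _; rewrite geq_max (leq_trans v1) ?leq_addr //=.
apply: leq_trans (size_polyMleq _ _) _.
by rewrite -[(k + d)%N]/(k + d).+1.-1 -!subn1 leq_sub2r // -addnS addnC leq_add.
Qed.

Lemma size_le_lower (s : {poly int}) k v :
  (size s <= 1)%N -> size_le k v -> size_le k (lower s v).
Proof.
move=> s1 /andP[v1 v2]; rewrite /size_le /= v1 /=.
apply: leq_trans (size_polyD _ _) _; rewrite geq_max v2 /=.
apply: leq_trans (size_polyMleq _ _) _.
by rewrite -[k]/k.+1.-1 -!subn1 leq_sub2r // -add1n leq_add.
Qed.

Lemma size_le_hyperbolic (s : {poly int}) e k v :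
  (size s <= 1)%N -> size_le k v -> size_le k (hyperbolic s e v).
Proof.
move=> s1 vk; rewrite /hyperbolic -[k]addn0; case: e.
  by apply: size_le_lower; rewrite ?size_polyN //; apply: size_le_upper; rewrite ?size_polyN.
by apply: size_le_upper => //; exact: size_le_lower.
Qed.

Lemma size_le_word_act u v m : size_le m v ->
  size_le (m + (size u).*2)%N (word_act ('X : {poly int}) u v).
Proof.
move=> vm; elim: u => [|l u IH]; first by rewrite addn0.
rewrite /= doubleS !addnS -addn1 -[X in (X + 1)%N]addn1 /letter_act.
have sz_twist b (T : {poly int}) w k : (size T <= 2)%N ->
    size_le k w -> size_le (k + 1)%N (twist T b w).
  move=> T2; case: b => /=; first exact: size_le_upper.
  by case/andP=> w1 w2; rewrite /size_le !(leq_trans _ (leq_addr _ _)).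
apply: (sz_twist); first by rewrite size_polyX.
apply: size_le_hyperbolic.
  by rewrite /letter_sign; case: ifP; rewrite ?size_polyN size_poly1.
by apply: sz_twist; rewrite // size_polyN size_polyX.
Qed.

(** The entries are polynomials in the parameter of degree less than [D], so they
are determined by [D] values. *)
Lemma pi_eq_of_word_act (u v : word 4) D :
    ((size u).*2 < D)%N -> ((size v).*2 < D)%N ->
    (forall k : nat, (k < D)%N ->
      word_act k%:Z u (1, 0) = word_act k%:Z v (1, 0) /\
      word_act k%:Z u (0, 1) = word_act k%:Z v (0, 1)) ->
  \pi_S2 u = \pi_S2 v.
Proof.
move=> uD vD uv.
have same (w : {poly int} * {poly int}) : size_le 1 w ->
    (forall k : nat, (k < D)%N -> word_act k%:Z u (eval_pair k%:Z w) =
                       word_act k%:Z v (eval_pair k%:Z w)) ->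
    word_act 'X u w = word_act 'X v w.
  move=> w1 uvw; have /andP[u1 u2] := size_le_word_act u w1.
  have /andP[v1 v2] := size_le_word_act v w1.
  have E k : (k < D)%N -> eval_pair k%:Z (word_act 'X u w) = eval_pair k%:Z (word_act 'X v w).
    by move=> kD; rewrite !eval_word_act uvw.
  rewrite [LHS]surjective_pairing [RHS]surjective_pairing; congr (_, _);
    apply: (@poly_eq_at_points _ _ D) => [||k kD];
    by [apply: leq_trans uD | apply: leq_trans vD | case: (E k kD)].
have e1 : word_act 'X u (1, 0) = word_act 'X v (1, 0) :> ({poly int} * {poly int})%type.
  apply: same; first by rewrite /size_le /= size_poly1 size_poly0.
  by move=> k kD; rewrite /eval_pair /= !hornerC; case: (uv k kD).
have e2 : word_act 'X u (0, 1) = word_act 'X v (0, 1) :> ({poly int} * {poly int})%type.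
  apply: same; first by rewrite /size_le /= size_poly1 size_poly0.
  by move=> k kD; rewrite /eval_pair /= !hornerC; case: (uv k kD).
apply: (@mulgI _ (\pi_S2 v)^-1)%g; rewrite mulVg; apply: act_faithful.
  by rewrite actM act_pi e1 -(act_pi _ v) -actM mulVg; exact: (act_pi _ [::]).
by rewrite actM act_pi e2 -(act_pi _ v) -actM mulVg; exact: (act_pi _ [::]).
Qed.

End Faithfulness.

(** * Computable functions *)

Section Decision.
Local Open Scope nat_scope.

Section Computable.

Definition computable n (f : n.-tuple nat -> nat) : Prop :=
  exists r : recfun n, forall v, computes r v (f v).

Lemma computable_ext n (f g : n.-tuple nat -> nat) :
  f =1 g -> computable f -> computable g.
Proof. by move=> fg [r fr]; exists r => v; rewrite -fg. Qed.

Lemma computable_proj n i : computable (fun v : n.-tuple nat => tnth v i).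
Proof. by exists (RProj i). Qed.

Lemma computable_zero n : computable (fun _ : n.-tuple nat => 0).
Proof. by exists (RZero n). Qed.

Lemma computable_comp1 n (h : nat -> nat) (f : n.-tuple nat -> nat) :
  computable (fun v : 1.-tuple nat => h (thead v)) -> computable f ->
  computable (fun v => h (f v)).
Proof.
move=> [rh hh] [rf hf]; exists (RComp rh (fun=> rf)) => v.
exists [tuple f v]; last exact: (hh [tuple f v]).
by move=> i; rewrite ord1.
Qed.

Definition computable2 (op : nat -> nat -> nat) : Prop :=
  computable (fun v : 2.-tuple nat => op (thead v) (tnth v ord_max)).

Lemma computable_comp2 n op (f g : n.-tuple nat -> nat) :
  computable2 op -> computable f -> computable g ->
  computable (fun v => op (f v) (g v)).
Proof.
move=> [ro ho] [rf hf] [rg hg].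
exists (RComp ro (fun i : 'I_2 => if i == ord0 then rf else rg)) => v.
exists [tuple f v; g v]; last exact: (ho [tuple f v; g v]).
by case=> -[|[|//]] lt2; rewrite /= (tnth_nth 0).
Qed.

Lemma computable_rec n (base : n.-tuple nat -> nat) (step : n.+2.-tuple nat -> nat) :
  computable base -> computable step ->
  computable (fun v : n.+1.-tuple nat =>
    let p := [tuple of behead v] in
    nat_rect (fun=> nat) (base p) (fun k z => step [tuple of k :: z :: p]) (thead v)).
Proof.
move=> [rb hb] [rs hs]; exists (RPrec rb rs) => v /=.
elim: (thead v) => [|k IH]; first exact: hb.
by eexists; [exact: IH|exact: hs].
Qed.

Lemma computable_succ n (f : n.-tuple nat -> nat) :
  computable f -> computable (fun v => (f v).+1).
Proof. by apply: (computable_comp1 (h := S)); exists RSucc. Qed.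

Lemma computable_const n c : computable (fun _ : n.-tuple nat => c).
Proof. by elim: c => [|c IH]; [exact: computable_zero|exact: computable_succ]. Qed.

Lemma computable2_rec (op : nat -> nat -> nat) (base : nat -> nat)
    (step : nat -> nat -> nat -> nat) :
    computable (fun v : 1.-tuple nat => base (thead v)) ->
    computable (fun v : 3.-tuple nat =>
      step (tnth v ord0) (tnth v (Ordinal (isT : 1 < 3))) (tnth v ord_max)) ->
    (forall x, op 0 x = base x) ->
    (forall k x, op k.+1 x = step k (op k x) x) ->
  computable2 op.
Proof.
move=> cb cs op0 opS; apply: computable_ext (computable_rec cb cs) => v /=.
have Ev : thead [tuple of behead v] = tnth v ord_max.
  by rewrite /thead !(tnth_nth 0) nth_behead.
elim: (thead v) => [|k IH] /=; first by rewrite op0 Ev.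
by rewrite opS -IH -Ev /thead !(tnth_nth 0).
Qed.

Lemma computable2_add : computable2 addn.
Proof.
apply: (computable2_rec (base := id) (step := fun _ z _ => z.+1)) => //.
- exact: computable_proj.
- exact/computable_succ/computable_proj.
Qed.

Lemma computable2_mul : computable2 muln.
Proof.
apply: (computable2_rec (base := fun=> 0) (step := fun _ z x => x + z)) => //.
- exact: computable_zero.
- by apply: computable_comp2 computable2_add _ _; exact: computable_proj.
Qed.

Lemma computable_pred n (f : n.-tuple nat -> nat) :
  computable f -> computable (fun v => (f v).-1).
Proof.
apply: computable_comp1.
apply: computable_ext (computable_rec (computable_zero 0) (computable_proj ord0)).
by move=> v /=; case: (thead v).
Qed.

Lemma computable2_sub : computable2 subn.
Proof.
have subr : computable2 (fun x y => y - x).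
  apply: (computable2_rec (base := id) (step := fun _ z _ => z.-1)) => //.
  - exact: computable_proj.
  - exact/computable_pred/computable_proj.
  - by move=> x; rewrite subn0.
  - by move=> k x; rewrite subnS.
exact: computable_comp2 subr (computable_proj ord_max) (computable_proj ord0).
Qed.

End Computable.

(** All data being coded by single numbers, unary functions are the ones that are
composed below; the closure properties are stated for expressions in a common
argument [x]. *)
Definition computable1 (f : nat -> nat) := computable (fun v : 1.-tuple nat => f (thead v)).

Section Comp.
Implicit Types F G H : nat -> nat.

Lemma comp_id : computable1 id. Proof. exact: computable_proj. Qed.
Lemma comp_const c : computable1 (fun=> c). Proof. exact: computable_const. Qed.
Lemma comp_comp F G : computable1 F -> computable1 G -> computable1 (fun x => F (G x)).
Proof. exact: computable_comp1. Qed.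
Lemma comp_add F G : computable1 F -> computable1 G -> computable1 (fun x => F x + G x).
Proof. exact: computable_comp2 computable2_add. Qed.
Lemma comp_mul F G : computable1 F -> computable1 G -> computable1 (fun x => F x * G x).
Proof. exact: computable_comp2 computable2_mul. Qed.
Lemma comp_sub F G : computable1 F -> computable1 G -> computable1 (fun x => F x - G x).
Proof. exact: computable_comp2 computable2_sub. Qed.
Lemma comp_ext F G : F =1 G -> computable1 F -> computable1 G.
Proof. by move=> FG; apply: computable_ext => v; rewrite FG. Qed.

Lemma comp_iter F K S :
  computable1 F -> computable1 K -> computable1 S -> computable1 (fun x => iter (K x) F (S x)).
Proof.
move=> cF; apply: (computable_comp2 (op := fun k s => iter k F s)).
apply: (computable2_rec (base := id) (step := fun _ z _ => F z)) => //.
- exact: computable_proj.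
- exact: computable_comp1 cF (computable_proj _).
Qed.

Lemma comp_if0 F G H : computable1 F -> computable1 G -> computable1 H ->
  computable1 (fun x => if F x == 0 then G x else H x).
Proof.
move=> cF cG cH.
have c1F := comp_sub (comp_const 1) cF.
apply: comp_ext (comp_add (comp_mul c1F cG) (comp_mul (comp_sub (comp_const 1) c1F) cH)).
move=> x; case: (F x) => [|k]; last by rewrite /= subSS sub0n mul0n mul1n.
by rewrite subn0 subnn mul1n mul0n addn0.
Qed.

Fixpoint isqrt n := if n is k.+1 then
  isqrt k + (1 - ((isqrt k).+1 * (isqrt k).+1 - k.+1)) else 0.

Lemma isqrt_bounds n : isqrt n * isqrt n <= n < (isqrt n).+1 * (isqrt n).+1.
Proof. by elim: n => [|n IH] //=; nia. Qed.

Lemma isqrt_eq s n : s * s <= n < s.+1 * s.+1 -> isqrt n = s.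
Proof. by have := isqrt_bounds n; nia. Qed.

Lemma comp_isqrt : computable1 isqrt.
Proof.
apply: computable_ext (computable_rec (n := 0) (computable_zero 0)
  (step := fun v => let z := tnth v ord_max in let k := tnth v ord0 in
     z + (1 - (z.+1 * z.+1 - k.+1))) _).
  by move=> v /=; elim: (thead v) => //= k ->; rewrite !(tnth_nth 0).
have ck := computable_succ (computable_proj (ord0 : 'I_2)).
have cz := computable_proj (ord_max : 'I_2).
apply: (computable_comp2 computable2_add cz).
apply: (computable_comp2 computable2_sub (computable_const _ 1)).
apply: (computable_comp2 computable2_sub _ ck).
exact: (computable_comp2 computable2_mul (computable_succ cz) (computable_succ cz)).
Qed.

(** As [(x + y)^2 <= npair x y < (x + y + 1)^2], an integer square root inverts this
pairing. *)
Definition npair x y := (x + y) * (x + y) + x.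
Definition nfst z := z - isqrt z * isqrt z.
Definition nsnd z := isqrt z - nfst z.

Lemma isqrt_npair x y : isqrt (npair x y) = x + y.
Proof. by apply: isqrt_eq; rewrite /npair; nia. Qed.

Lemma nfst_npair x y : nfst (npair x y) = x.
Proof. by rewrite /nfst isqrt_npair /npair addKn. Qed.

Lemma nsnd_npair x y : nsnd (npair x y) = y.
Proof. by rewrite /nsnd nfst_npair isqrt_npair addKn. Qed.

Lemma comp_npair F G :
  computable1 F -> computable1 G -> computable1 (fun x => npair (F x) (G x)).
Proof.
by move=> cF cG; apply/comp_add/cF; apply: comp_mul; exact: comp_add.
Qed.

Lemma comp_nfst F : computable1 F -> computable1 (fun x => nfst (F x)).
Proof.
apply: comp_comp; apply: comp_sub comp_id _.
by apply: comp_mul; exact: comp_isqrt.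
Qed.

Lemma comp_nsnd F : computable1 F -> computable1 (fun x => nsnd (F x)).
Proof.
by apply: comp_comp; apply: comp_sub comp_isqrt _; apply: comp_nfst comp_id.
Qed.

Lemma comp_succ F : computable1 F -> computable1 (fun x => (F x).+1).
Proof. exact: computable_succ. Qed.
Lemma comp_pred F : computable1 F -> computable1 (fun x => (F x).-1).
Proof. exact: computable_pred. Qed.

Lemma comp_sum H K : computable1 H -> computable1 K ->
  computable1 (fun x => \sum_(i < K x) H (npair x i)).
Proof.
move=> cH cK.
(* The state of the loop: the argument, the index and the accumulated sum. *)
pose next c := npair (nfst c) (npair (nfst (nsnd c)).+1
  (nsnd (nsnd c) + H (npair (nfst c) (nfst (nsnd c))))).
have cnext : computable1 next.
  have c1 := comp_nfst comp_id; have c2 := comp_nsnd comp_id.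
  apply: comp_npair => //; apply: comp_npair; first exact/comp_succ/comp_nfst.
  apply: comp_add; first exact: comp_nsnd.
  by apply: comp_comp cH _; apply: comp_npair => //; exact: comp_nfst.
have nextE x k : iter k next (npair x (npair 0 0)) =
    npair x (npair k (\sum_(i < k) H (npair x i))).
  elim: k => [|k IH]; first by rewrite big_ord0.
  by rewrite iterS IH /next !(nfst_npair, nsnd_npair) big_ord_recr.
have cit := comp_iter cnext cK (comp_npair comp_id (comp_const (npair 0 0))).
by apply: comp_ext (comp_nsnd (comp_nsnd cit)) => x; rewrite nextE !nsnd_npair.
Qed.

Lemma comp_divn F b : computable1 F -> computable1 (fun x => F x %/ b).
Proof.
case: b => [|b]; first by move=> _; exact: comp_ext (comp_const 0).
apply: (comp_comp (F := divn^~ b.+1)).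
(* The quotient counts the positive multiples of the divisor up to [c]. *)
apply: comp_ext
  (comp_sum (K := id) (H := fun z => 1 - ((nsnd z).+1 * b.+1 - nfst z)) _ comp_id).
  move=> c; under eq_bigr => i _ do rewrite nfst_npair nsnd_npair.
  have E k : \sum_(i < k) (1 - (i.+1 * b.+1 - c)) = minn k (c %/ b.+1).
    elim: k => [|k IH]; first by rewrite big_ord0 min0n.
    rewrite big_ord_recr /= IH; have := leq_divRL k.+1 c (ltn0Sn b).
    by case: (leqP (k.+1 * b.+1) c); lia.
  by rewrite E; apply/minn_idPr; exact: leq_div.
apply: comp_sub (comp_const 1) _; apply: comp_sub; last exact: comp_nfst comp_id.
by apply: comp_mul (comp_const _); exact/comp_succ/comp_nsnd/comp_id.
Qed.

Lemma comp_modn F b : computable1 F -> computable1 (fun x => F x %% b).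
Proof.
move=> cF; apply: comp_ext (comp_sub cF (comp_mul (comp_divn b cF) (comp_const b))).
by move=> x; rewrite {1}(divn_eq (F x) b) addKn.
Qed.

Lemma comp_expn b F : computable1 F -> computable1 (fun x => b ^ F x).
Proof.
move=> cF; apply: comp_ext (comp_iter (comp_mul (comp_const b) comp_id) cF (comp_const 1)).
by move=> x; elim: (F x) => //= k ->; rewrite expnS.
Qed.

Lemma comp_nth (tbl : seq (nat -> nat)) F G :
  (forall i, computable1 (nth id tbl i)) ->
  computable1 F -> computable1 G -> computable1 (fun x => nth id tbl (F x) (G x)).
Proof.
elim: tbl F => [|f tbl IH] F ctbl cF cG.
  by apply: comp_ext cG => x; rewrite nth_nil.
have IH' := IH (fun x => (F x).-1) (fun i => ctbl i.+1) (comp_pred cF) cG.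
apply: comp_ext (comp_if0 cF (comp_comp (ctbl 0) cG) IH') => x.
by case: (F x).
Qed.

End Comp.

(** * Evaluation of words by arithmetic on numbers *)

(** A single number holds the parameter T and a pair of integers, each integer
being represented as a difference of two natural numbers. *)
Definition reg_T s := nfst s.
Definition reg_xp s := nfst (nfst (nsnd s)).
Definition reg_xm s := nsnd (nfst (nsnd s)).
Definition reg_yp s := nfst (nsnd (nsnd s)).
Definition reg_ym s := nsnd (nsnd (nsnd s)).
Definition reg_pack T xp xm yp ym := npair T (npair (npair xp xm) (npair yp ym)).

Definition reg_val s : int * int :=
  ((reg_xp s)%:Z - (reg_xm s)%:Z, (reg_yp s)%:Z - (reg_ym s)%:Z)%R.

Lemma reg_packE T xp xm yp ym : let s := reg_pack T xp xm yp ym in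
  ((reg_T s = T) * (reg_xp s = xp) * (reg_xm s = xm) * (reg_yp s = yp) * (reg_ym s = ym))%type.
Proof.
by rewrite /reg_T /reg_xp /reg_xm /reg_yp /reg_ym /reg_pack /= !(nfst_npair, nsnd_npair).
Qed.

Definition implements (f : nat -> nat) (phi : nat -> int * int -> int * int) :=
  computable1 f /\
  forall s, reg_T (f s) = reg_T s /\ reg_val (f s) = phi (reg_T s) (reg_val s).

Definition implementable phi := exists f, implements f phi.

Lemma implementable_ext phi psi :
  (forall T v, phi T v = psi T v) -> implementable phi -> implementable psi.
Proof.
by move=> E [f [cf Ef]]; exists f; split=> // s; rewrite -E; exact: Ef.
Qed.

Lemma implementable_comp phi psi : implementable phi -> implementable psi ->
  implementable (fun T v => phi T (psi T v)).
Proof.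
move=> [f [cf Ef]] [g [cg Eg]]; exists (f \o g); split=> [|s /=].
  exact: comp_comp.
by have [T1 ->] := Ef (g s); have [T2 ->] := Eg s; rewrite T1 T2.
Qed.

Lemma implementable_id : implementable (fun T v => v).
Proof. by exists id; split; first exact: comp_id. Qed.

Ltac comp_tac := repeat first [assumption | exact: comp_id | exact: comp_const
  | apply: comp_npair | apply: comp_nfst | apply: comp_nsnd | apply: comp_succ
  | apply: comp_add | apply: comp_sub | apply: comp_mul].

Lemma implementable_upper (cp cm : nat -> nat) : computable1 cp -> computable1 cm ->
  implementable (fun T => upper (Posz (cp T) - Posz (cm T))%R).
Proof.
move=> ccp ccm.
exists (fun s => reg_pack (reg_T s)
  (reg_xp s + (cp (reg_T s) * reg_yp s + cm (reg_T s) * reg_ym s))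
  (reg_xm s + (cp (reg_T s) * reg_ym s + cm (reg_T s) * reg_yp s)) (reg_yp s) (reg_ym s)).
split; last first.
  by move=> s; rewrite /reg_val /upper !reg_packE /=; split=> //; congr (_, _); lia.
have cT : computable1 (fun s => reg_T s) by rewrite /reg_T; comp_tac.
have ? := comp_comp ccp cT; have ? := comp_comp ccm cT.
by rewrite /reg_pack /reg_xp /reg_xm /reg_yp /reg_ym; comp_tac.
Qed.

Lemma implementable_lower (cp cm : nat -> nat) : computable1 cp -> computable1 cm ->
  implementable (fun T => lower (Posz (cp T) - Posz (cm T))%R).
Proof.
move=> ccp ccm.
exists (fun s => reg_pack (reg_T s) (reg_xp s) (reg_xm s)
  (reg_yp s + (cp (reg_T s) * reg_xp s + cm (reg_T s) * reg_xm s))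
  (reg_ym s + (cp (reg_T s) * reg_xm s + cm (reg_T s) * reg_xp s))).
split; last first.
  by move=> s; rewrite /reg_val /lower !reg_packE /=; split=> //; congr (_, _); lia.
have cT : computable1 (fun s => reg_T s) by rewrite /reg_T; comp_tac.
have ? := comp_comp ccp cT; have ? := comp_comp ccm cT.
by rewrite /reg_pack /reg_xp /reg_xm /reg_yp /reg_ym; comp_tac.
Qed.

(** Every letter acts by a composite of shears by 1, -1, T or -T. *)
Lemma implementable_word_act u : implementable (fun T => word_act (Posz T) u).
Proof.
have c0 := comp_const 0; have c1 := comp_const 1; have cT := comp_id.
have up := implementable_upper; have lo := implementable_lower.
have hyperbolicI (neg e : bool) :
    implementable (fun T => hyperbolic (if neg then -1 else 1 : int)%R e).
  have u1 := up _ _ c1 c0; have un1 := up _ _ c0 c1.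
  have l1 := lo _ _ c1 c0; have ln1 := lo _ _ c0 c1.
  case: neg; case: e; rewrite /hyperbolic ?opprK.
  - exact: implementable_comp l1 u1.
  - exact: implementable_comp un1 ln1.
  - exact: implementable_comp ln1 un1.
  - exact: implementable_comp u1 l1.
have twI b : implementable (fun T => twist (Posz T) b).
  case: b; last exact: implementable_id.
  apply: implementable_ext (up _ _ cT c0) => T v.
  by rewrite subr0.
have twNI b : implementable (fun T => twist (- Posz T)%R b).
  case: b; last exact: implementable_id.
  apply: implementable_ext (up _ _ c0 cT) => T v.
  by rewrite sub0r.
elim: u => [|l u IH]; first exact: implementable_id.
pose neg := (l.1 != 0 :> nat) && (l.1 != 3 :> nat); pose b := (2 <= l.1).
apply: implementable_ext (implementable_comp (twI b)
  (implementable_comp (hyperbolicI neg l.2) (implementable_comp (twNI b) IH))) => T v.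
rewrite /= /letter_act; congr (twist _ _ (hyperbolic _ _ _)).
by rewrite /neg /letter_sign -negb_or; case: (_ || _).
Qed.

Lemma word_table (ws : seq (word 4)) : exists tbl : seq (nat -> nat),
  forall i, implements (nth id tbl i) (fun T => word_act (Posz T) (nth [::] ws i)).
Proof.
elim: ws => [|u ws [tbl tblE]].
  by exists [::] => i; rewrite !nth_nil; split; first exact: comp_id.
have [f fE] := implementable_word_act u.
by exists (f :: tbl) => -[|i] /=.
Qed.

(** [k] is the fuel; [k = c] is enough, a code [c] having at most [c] digits. *)
Fixpoint digits b k c := if k is k'.+1 then
  (if c == 0 then [::] else c.-1 %% b :: digits b k' (c.-1 %/ b)) else [::].

Lemma size_digits b k c : size (digits b k c) <= k.
Proof. by elim: k c => //= k IH c; case: ifP => //= _; rewrite ltnS. Qed.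

(** Bijective numeration in base [b], as in [word_code], for arbitrary lists of
digits. *)
Definition code b (ds : seq nat) := foldr (fun d c => c * b + d.+1) 0 ds.

Lemma code_digits b ds k : all (fun d => d < b) ds -> size ds <= k ->
  digits b k (code b ds) = ds.
Proof.
elim: ds k => [|d ds IH] [|k] //= /andP[db dsb] szk.
rewrite addnS /= modnMDl modn_small // divnMDl ?(leq_ltn_trans _ db) //.
by rewrite divn_small // addn0 IH.
Qed.

Lemma size_le_code b ds : all (fun d => d < b) ds -> size ds <= code b ds.
Proof.
elim: ds => //= d ds IH /andP[db dsb]; have := IH dsb.
by case: b db {IH dsb} => // b _; nia.
Qed.

Lemma code_lt b ds : all (fun d => d < b) ds -> code b ds < b.+1 ^ size ds.
Proof.
elim: ds => //= d ds IH /andP[db dsb]; have := IH dsb; rewrite expnS; nia.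
Qed.

(** The machine reads the first digit first, so the letters that it reads last act
last; the word that acts is spelled in reverse. *)
Definition spell (ws : seq (word 4)) ds : word 4 :=
  flatten (rev [seq nth [::] ws d | d <- ds]).

Lemma spell_cons ws d ds : spell ws (d :: ds) = spell ws ds ++ nth [::] ws d.
Proof. by rewrite /spell /= rev_cons -cats1 flatten_cat /= cats0. Qed.

Lemma size_spell ws ds : size (spell ws ds) <= (\max_(u <- ws) size u) * size ds.
Proof.
elim: ds => [|d ds IH] /=; first by rewrite /spell.
rewrite spell_cons size_cat mulnS addnC leq_add //.
case: (ltnP d (size ws)) => dws; last by rewrite nth_default.
by apply: leq_bigmax_seq; rewrite ?mem_nth.
Qed.

(** A configuration pairs the code of the digits that remain to be read with a
state. *)
Definition step b tbl z := if nfst z == 0 then z else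
  npair ((nfst z).-1 %/ b) (nth id tbl ((nfst z).-1 %% b) (nsnd z)).

Definition run b tbl c s := nsnd (iter c (step b tbl) (npair c s)).

Lemma run_correct ws : exists2 tbl, (forall i, computable1 (nth id tbl i)) &
  forall b c s, reg_val (run b tbl c s) =
    word_act (Posz (reg_T s)) (spell ws (digits b c c)) (reg_val s).
Proof.
have [tbl tblE] := word_table ws; exists tbl => [i|b c s].
  by case: (tblE i).
rewrite /run; move: {1 3}c => k; elim: k c s => [|k IH] c s.
  by rewrite /= nsnd_npair.
rewrite iterSr {2}/step nfst_npair /=; case: eqP => [->|/eqP c0].
  suff -> : iter k (step b tbl) (npair 0 s) = npair 0 s by rewrite nsnd_npair.
  by elim: k {IH} => //= k ->; rewrite /step nfst_npair.
rewrite nsnd_npair IH spell_cons /word_act foldr_cat.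
by have [_ /(_ s)[-> ->]] := tblE (c.-1 %% b).
Qed.

Lemma comp_run b tbl F S :
  (forall i, computable1 (nth id tbl i)) -> computable1 F -> computable1 S ->
  computable1 (fun x => run b tbl (F x) (S x)).
Proof.
move=> ctbl cF cS; apply: comp_nsnd; apply: (comp_iter _ cF (comp_npair cF cS)).
have c1 := comp_nfst comp_id; have c2 := comp_nsnd comp_id.
apply: comp_if0 => //; first exact: comp_id.
apply: comp_npair; first exact/comp_divn/comp_pred.
by apply: comp_nth => //; apply/comp_modn/comp_pred.
Qed.

(** The sum of both truncated subtractions is the distance; [x = x'] is tested as
[xp + xm' = xp' + xm]. *)
Definition reg_diff s t :=
  let x := reg_xp s + reg_xm t in let x' := reg_xp t + reg_xm s in
  let y := reg_yp s + reg_ym t in let y' := reg_yp t + reg_ym s in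
  ((x - x') + (x' - x)) + ((y - y') + (y' - y)).

Lemma reg_diff_eq0 s t : reg_diff s t = 0 <-> reg_val s = reg_val t.
Proof.
rewrite /reg_diff /reg_val; split=> [d0|[]]; last by lia.
by congr (_, _); lia.
Qed.

Lemma comp_reg_diff F G : computable1 F -> computable1 G ->
  computable1 (fun x => reg_diff (F x) (G x)).
Proof.
by move=> cF cG; rewrite /reg_diff /reg_xp /reg_xm /reg_yp /reg_ym; comp_tac.
Qed.

(** Since the machine reverses the order of the factors, feeding it with the
inverses of the generators makes it evaluate the inverse of the product. *)
Definition inverse_words (gs : seq S2) : seq (word 4) :=
  [seq repr ((g^-1)%g : S2) | g <- gs].

Definition decode (gs : seq S2) b c : S2 :=
  (\prod_(d <- digits b c c) nth 1 gs d)%g.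

Lemma pi_spell (gs : seq S2) ds :
  \pi_S2 (spell (inverse_words gs) ds) = ((\prod_(d <- ds) nth 1 gs d)^-1)%g.
Proof.
elim: ds => [|d ds IH]; first by rewrite /spell big_nil invg1.
rewrite spell_cons big_cons invgM pi_cat IH; congr (_ * _)%g.
case: (ltnP d (size gs)) => dgs; first by rewrite (nth_map 1%g) // reprK.
by rewrite !nth_default ?size_map // invg1.
Qed.

(** Equality in [S2] is tested by comparing the images of (1, 0) and (0, 1) for
enough values of T. *)
Lemma decode_eq_computable (gs hs : seq S2) b b' : exists2 h, computable1 h &
  forall x y, h (npair x y) = 0 <-> decode gs b x = decode hs b' y.
Proof.
pose us := inverse_words gs; pose vs := inverse_words hs.
have [tu ctu tuE] := run_correct us; have [tv ctv tvE] := run_correct vs.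
pose cu := \max_(u <- us) size u; pose cv := \max_(u <- vs) size u.
pose e1 T := reg_pack T 1 0 0 0; pose e2 T := reg_pack T 0 0 1 0.
pose D z := ((cu * nfst z + cv * nsnd z).*2).+1.
pose H t :=
  reg_diff (run b tu (nfst (nfst t)) (e1 (nsnd t)))
           (run b' tv (nsnd (nfst t)) (e1 (nsnd t))) +
  reg_diff (run b tu (nfst (nfst t)) (e2 (nsnd t)))
           (run b' tv (nsnd (nfst t)) (e2 (nsnd t))).
have e1E T : (reg_val (e1 T) = (1, 0)%R) * (reg_T (e1 T) = T).
  by rewrite /reg_val !reg_packE.
have e2E T : (reg_val (e2 T) = (0, 1)%R) * (reg_T (e2 T) = T).
  by rewrite /reg_val !reg_packE.
exists (fun z => \sum_(i < D z) H (npair z i)).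
  apply: comp_sum; last first.
    suff cD : computable1 (fun z => ((cu * nfst z + cv * nsnd z) * 2).+1).
      by apply: comp_ext cD => z; rewrite muln2.
    by comp_tac.
  rewrite /H /e1 /e2 /reg_pack.
  by apply: comp_add; apply: comp_reg_diff; apply: comp_run => //; comp_tac.
move=> x y; rewrite /decode; set dx := digits b x x; set dy := digits b' y y.
have HE T : H (npair (npair x y) T) = 0 <->
    word_act (Posz T) (spell us dx) (1, 0)%R = word_act (Posz T) (spell vs dy) (1, 0)%R /\
    word_act (Posz T) (spell us dx) (0, 1)%R = word_act (Posz T) (spell vs dy) (0, 1)%R.
  rewrite /H !(nfst_npair, nsnd_npair).
  have := reg_diff_eq0 (run b tu x (e1 T)) (run b' tv y (e1 T)).
  have := reg_diff_eq0 (run b tu x (e2 T)) (run b' tv y (e2 T)).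
  rewrite !tuE !tvE !e1E !e2E -/dx -/dy => -[d2 d2'] [d1 d1'].
  split=> [/eqP|[/d1' -> /d2' ->] //].
  by rewrite addn_eq0 => /andP[/eqP/d1 -> /eqP/d2 ->].
have -> : \sum_(i < D (npair x y)) H (npair (npair x y) i) = 0 <->
    \pi_S2 (spell us dx) = \pi_S2 (spell vs dy).
  split=> [/eqP|E].
    rewrite sum_nat_eq0 => /forallP HD.
    apply: (@pi_eq_of_word_act _ _ (D (npair x y))).
    - rewrite ltnS leq_double nfst_npair nsnd_npair; apply: leq_trans (size_spell _ _) _.
      by rewrite -/cu (leq_trans _ (leq_addr _ _)) // leq_mul2l size_digits orbT.
    - rewrite ltnS leq_double nfst_npair nsnd_npair; apply: leq_trans (size_spell _ _) _.
      by rewrite -/cv (leq_trans _ (leq_addl _ _)) // leq_mul2l size_digits orbT.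
    by move=> k kD; apply/HE/eqP; exact: (HD (Ordinal kD)).
  by apply: big1 => i _; apply/HE; rewrite -!act_pi E.
by rewrite !pi_spell; split=> [/invg_inj|->].
Qed.

(** * Decidability of membership *)

Section Membership.
Variable W : set Fab.
Hypotheses (finW : finite_set W) (W1 : ~ W 1%g).
Hypothesis gradW : graded (submonoid_gen W).

Lemma decode_in_submonoid (G : set S2) gs b c :
  (forall g, g \in gs -> G g) -> submonoid_gen G (decode gs b c).
Proof.
move=> gsG; rewrite /decode; elim: (digits b c c) => [|d ds [u Gu Eu]].
  by exists [::]; rewrite ?big_nil.
rewrite big_cons; case: (ltnP d (size gs)) => dgs; last first.
  by rewrite nth_default // mul1g; exists u.
exists (nth 1%g gs d :: u); last by rewrite big_cons Eu.
by move=> x; rewrite inE => /predU1P[->|/Gu //]; apply/gsG/mem_nth.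
Qed.

Lemma decode_code gs b ds : all (fun d => d < b) ds ->
  decode gs b (code b ds) = (\prod_(d <- ds) nth 1%g gs d)%g.
Proof. by move=> dsb; rewrite /decode code_digits // size_le_code. Qed.

Lemma word_code_code n (w : word n) :
  word_code w = code n.*2 (map (@letter_code n) w).
Proof. by elim: w => //= l w ->. Qed.

Lemma letter_code_lt n (l : 'I_n * bool) : letter_code l < n.*2.
Proof. by rewrite /letter_code; case: l => [[i lti] e] /=; lia. Qed.

Lemma letter_codes_lt n (w : word n) :
  all (fun d => d < n.*2) (map (@letter_code n) w).
Proof. by apply/allP => _ /mapP[l _ ->]; exact: letter_code_lt. Qed.

Definition letter_value (G : groupType) n (B : 'I_n -> G) d : G :=
  if insub d./2 is Some i then (if odd d then (B i)^-1%g else B i) else 1%g.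

Lemma letter_value_code (G : groupType) n (B : 'I_n -> G) (l : 'I_n * bool) :
  letter_value B (letter_code l) = if l.2 then (B l.1)^-1%g else B l.1.
Proof.
rewrite /letter_value /letter_code addnC half_bit_double valK.
by rewrite oddD odd_double addbF; case: l.2.
Qed.

Lemma decode_word_code n (B : 'I_n -> S2) (w : word n) :
  decode (mkseq (letter_value B) n.*2) n.*2 (word_code w) = word_eval B w.
Proof.
rewrite word_code_code decode_code ?letter_codes_lt //.
rewrite /word_eval big_map; apply: eq_bigr => l _.
by rewrite nth_mkseq ?letter_code_lt // letter_value_code.
Qed.

Lemma size_le_word_code n (w : word n) : size w <= word_code w.
Proof.
by rewrite word_code_code -(size_map (@letter_code n)) size_le_code ?letter_codes_lt.
Qed.

(** The length bound for expressions makes the codes of all relevant products of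
generators smaller than a computable function of the input word, so a bounded
search suffices.  Codes in the search range that are not the code of a list of
generators are harmless, as every code decodes to an element of the submonoid. *)
Lemma membership_decidable_double :
  membership_decidable (submonoid_gen (double_gens W)).
Proof.
move=> n B _; have /finite_seqP[gs gsE] := finite_double_gens finW.
have [K KP] := double_gens_linear finW W1 gradW.
pose F (l : 'I_n * bool) := if l.2 then (B l.1)^-1%g else B l.1.
have [L LP] : exists L, forall l, [set: 'I_n * bool] l -> free_length (fold (F l)) <= L.
  exact: (finite_bounded _ finite_finset).
pose bs := mkseq (letter_value B) n.*2; pose m := size gs.
have [h ch hE] := decode_eq_computable bs gs n.*2 m.
pose bound c := m.+1 ^ (K * (L * c + 2)).
pose f c := 1 - (1 - \sum_(i < bound c) (1 - h (npair c i))).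
have [r rP] : computable1 f.
  apply: comp_sub (comp_const 1) _; apply: comp_sub (comp_const 1) _.
  apply: (comp_sum (H := fun z => 1 - h z)); first exact: comp_sub (comp_const 1) ch.
  apply: comp_expn; apply: comp_mul (comp_const K) _; apply: comp_add _ (comp_const 2).
  exact: comp_mul (comp_const L) comp_id.
exists r => w; exists (0 < \sum_(i < bound (word_code w)) (1 - h (npair (word_code w) i))).
  have := rP [tuple word_code w]; congr (computes _ _ _).
  by rewrite /f /=; case: (\sum_(_ < _) _) => // k; rewrite subSS sub0n.
have hitE i : (0 < 1 - h (npair (word_code w) i)) <-> word_eval B w = decode gs m i.
  rewrite subn_gt0 ltnS leqn0 -(decode_word_code B w) -hE.
  by split=> [/eqP|->].
split=> [|[us Gus Eus]].
  rewrite lt0n sum_nat_eq0 negb_forall => /existsP[i]; rewrite -lt0n => /hitE ->.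
  by apply: decode_in_submonoid => g ggs; rewrite gsE.
pose ds := map (index^~ gs) us.
have usgs u : u \in us -> u \in gs by move/Gus; rewrite gsE.
have dsm : all (fun d => d < m) ds.
  by apply/allP => _ /mapP[u /usgs ugs ->]; rewrite index_mem.
have Eds : decode gs m (code m ds) = word_eval B w.
  rewrite decode_code // -Eus big_map big_seq [RHS]big_seq.
  by apply: eq_bigr => u /usgs ugs; rewrite nth_index.
have lt_bound : code m ds < bound (word_code w).
  apply: leq_trans (code_lt dsm) _; rewrite leq_pexp2l // size_map.
  apply: leq_trans (KP us Gus) _; rewrite leq_mul2l leq_add2r Eus.
  rewrite /word_eval (morph_prod foldM) (leq_trans (free_length_prod (L := L) _)) ?orbT //.
    by move=> l _; exact: LP.
  by rewrite leq_mul2l size_le_word_code orbT.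
rewrite (bigD1 (Ordinal lt_bound)) //= addn_gt0; apply/orP; left.
exact/hitE/esym.
Qed.

End Membership.

End Decision.

Theorem corollary6p18 (W : set Fab) (finW : finite_set W) (W1 : ~ W 1) :
  let W' : set Fcd := ab_to_dc @` W in
  let M : set S2 := submonoid_gen (Fab_to_S2 @` W `|` Fcd_to_S2 @` W') in
  graded (submonoid_gen W) ->
  (graded M /\ linear_distortion M) /\ membership_decidable M.
Proof.
move=> W' M gradW; rewrite /M /W' double_gensE; split; first split.
- exact: graded_double.
- exact: linear_distortion_double.
- exact: membership_decidable_double.
Qed.
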